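(* Let $T$ be a tree with two color classes (bipartition classes) $A$ and $B$, where $|A|\le|B|$, and let $p\ge 3$. Then for all sufficiently large $n$: (i) if $T$ has a leaf in $A$ and the independence number satisfies $\alpha(T)=|B|$, then $H(n,p,|A|)$ is the unique extremal graph for $T^{p+1}$; (ii) if the minimum degree (in $T$) over vertices of $A$ equals $2$, then $H'(n,p,|A|)$ is the unique extremal graph for $T^{p+1}$.
   Context: All graphs are finite, simple, undirected. For a graph $H$, the blow-up $H^{p+1}$ is the graph obtained by replacing each edge of $H$ by a clique $K_{p+1}$ containing that edge, where the new vertices added for different edges are all distinct. An extremal graph for $H$ is an $n$-vertex $H$-free graph with the maximum possible number of edges among $n$-vertex $H$-free graphs. $T_{n,p}$ is the Turán graph: the complete $p$-partite graph on $n$ vertices with class sizes as equal as possible. For vertex-disjoint graphs $H,G$, $H\bigotimes G$ denotes the graph obtained from their disjoint union by joining every vertex of $H$ to every vertex of $G$. $H(n,p,s)=K_{s-1}\bigotimes T_{n-s+1,p}$, and $H'(n,p,s)$ denotes any graph obtained from $H(n,p,s)$ by adding one extra edge inside one class of the $T_{n-s+1,p}$ part (these all have the same number of edges; ''unique'' means every extremal graph is of this form). *)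

(* Defs.v *)
From mathcomp Require Import all_boot.

Set Implicit Arguments.
Unset Strict Implicit.
Unset Printing Implicit Defensive.

Record sgraph := SGraph {
  svertex :> finType;
  sedge : rel svertex;
  sedge_sym : symmetric sedge;
  sedge_irrefl : irreflexive sedge }.

Notation "x -- y" := (sedge x y) (at level 30).

Definition edges (G : sgraph) : {set {set G}} :=
  [set [set x; y] | x in G, y in G & x -- y].

Definition degree (G : sgraph) (x : G) : nat := #|[set y | x -- y]|.

Definition leaf (G : sgraph) (x : G) : bool := degree x == 1.

(* Requiring a vertex that attains [m] makes this fail when [S] is empty. *)
Definition is_min_degree_over (G : sgraph) (S : {set G}) (m : nat) : Prop :=
  (exists2 x, x \in S & degree x = m) /\ {in S, forall x, m <= degree x}.

Definition independent (G : sgraph) (S : {set G}) : bool :=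
  [forall x in S, forall y in S, ~~ (x -- y)].

Definition independence_number (G : sgraph) : nat :=
  \max_(S : {set G} | independent S) #|S|.

Definition bipartition (G : sgraph) (A B : {set G}) : Prop :=
  [/\ A :|: B = setT, [disjoint A & B], independent A & independent B].

Definition connected (G : sgraph) : Prop :=
  forall x y : G, connect (@sedge G) x y.

(* [ucycle] also accepts the empty sequence and, by going back and forth along
   an edge, sequences of two vertices; graph cycles have at least three. *)
Definition acyclic (G : sgraph) : Prop :=
  forall c : seq G, ucycle (@sedge G) c -> size c < 3.

Definition is_tree (G : sgraph) : Prop := [/\ 0 < #|G|, connected G & acyclic G].

Definition contains (G H : sgraph) : Prop :=
  exists2 f : H -> G, injective f & forall x y, x -- y -> f x -- f y.

Definition isomorphic (G H : sgraph) : Prop :=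
  exists2 f : G -> H, bijective f & forall x y, f x -- f y = x -- y.

Definition extremal (n : nat) (H G : sgraph) : Prop :=
  [/\ #|G| = n, ~ contains G H &
      forall G' : sgraph, #|G'| = n -> ~ contains G' H ->
        #|edges G'| <= #|edges G|].

Section Complete.
Variable n : nat.
Definition complete_rel : rel 'I_n := fun x y => x != y.
Lemma complete_sym : symmetric complete_rel.
Proof. by move=> x y; rewrite /complete_rel eq_sym. Qed.
Lemma complete_irrefl : irreflexive complete_rel.
Proof. by move=> x; rewrite /complete_rel eqxx. Qed.
Definition complete : sgraph := SGraph complete_sym complete_irrefl.
End Complete.

(* The classes of the Turán graph are the residue classes modulo [p]; those of
   'I_n have sizes differing by at most one. *)
Section Turan.
Variables n p : nat.
Definition turan_rel : rel 'I_n := fun x y => x != y %[mod p].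
Lemma turan_sym : symmetric turan_rel.
Proof. by move=> x y; rewrite /turan_rel eq_sym. Qed.
Lemma turan_irrefl : irreflexive turan_rel.
Proof. by move=> x; rewrite /turan_rel eqxx. Qed.
Definition turan : sgraph := SGraph turan_sym turan_irrefl.
End Turan.

Section Join.
Variables G H : sgraph.
Definition join_rel : rel (G + H) := fun u v =>
  match u, v with
  | inl x, inl y => x -- y
  | inr x, inr y => x -- y
  | _, _ => true
  end.
Lemma join_sym : symmetric join_rel.
Proof. by case=> x [] y //=; apply: sedge_sym. Qed.
Lemma join_irrefl : irreflexive join_rel.
Proof. by case=> x /=; apply: sedge_irrefl. Qed.
Definition join : sgraph := SGraph join_sym join_irrefl.
End Join.

Section AddEdge.
Variables (G : sgraph) (u v : G).
Definition add_edge_rel : rel G := fun x y =>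
  x -- y || (x != y) && ([set x; y] == [set u; v]).
Lemma add_edge_sym : symmetric add_edge_rel.
Proof. by move=> x y; rewrite /add_edge_rel sedge_sym eq_sym setUC. Qed.
Lemma add_edge_irrefl : irreflexive add_edge_rel.
Proof. by move=> x; rewrite /add_edge_rel sedge_irrefl eqxx. Qed.
Definition add_edge : sgraph := SGraph add_edge_sym add_edge_irrefl.
End AddEdge.

(* [blowup G k] replaces every edge of [G] by a clique on [k] vertices: [inr (e, i)]
   is the [i]-th of the [k - 2] new vertices attached to the edge [e]. *)
Section Blowup.
Variables (G : sgraph) (k : nat).
Definition edge_type : finType := {e : {set G} | e \in edges G}.
Definition blowup_rel : rel (G + edge_type * 'I_(k - 2)) := fun u v =>
  match u, v with
  | inl x, inl y => x -- y
  | inl x, inr (e, _) => x \in val e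
  | inr (e, _), inl x => x \in val e
  | inr (e, i), inr (f, j) => (e == f) && (i != j)
  end.
Lemma blowup_sym : symmetric blowup_rel.
Proof.
case=> [x|[e i]] [y|[f j]] //=; first exact: sedge_sym.
by rewrite eq_sym [i == j]eq_sym.
Qed.
Lemma blowup_irrefl : irreflexive blowup_rel.
Proof. by case=> [x|[e i]] /=; rewrite ?sedge_irrefl ?eqxx. Qed.
Definition blowup : sgraph := SGraph blowup_sym blowup_irrefl.
End Blowup.

(* [Hgraph n p s] has [n] vertices when [0 < s <= n]. *)
Definition Hgraph (n p s : nat) : sgraph :=
  join (complete (s - 1)) (turan (n - s + 1) p).

(* The two ends of the extra edge lie in one class of the Turán graph. *)
Definition is_Hprime (n p s : nat) (G : sgraph) : Prop :=
  exists u v : 'I_(n - s + 1), [/\ u != v, u = v %[mod p] &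
    isomorphic G (@add_edge (Hgraph n p s) (inr u) (inr v))].

(* Main.v *)
Require Import Defs.
From mathcomp Require Import all_boot.
From mathcomp Require Import fingroup perm.
From mathcomp Require Import zify.

(* Write L for the blow-up, s = |A| and t(N) for the number of pairs of
   distinct vertices lying in a common class of the Turán graph on N vertices,
   so that H(n,p,s) has C(n,2) - t(n-s+1) edges.

   Deleting vertices of degree smaller than e(H(n,p,s)) - e(H(n-1,p,s)) raises
   the excess of e(G) over e(H(n,p,s)) at every step, so it is enough to treat
   an L-free G, as dense as claimed, in which every vertex has at most about n/p
   non-neighbours.  The Erdős-Stone argument yields disjoint U_1, ..., U_p of
   size about n/p, each vertex of U_i having few neighbours in U_i, as otherwise
   a large complete (p+1)-partite graph, hence L, appears.  Let D be the set of
   vertices with many neighbours in every U_i; the other vertices split into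
   classes V_i, according to the U_i in which they have few neighbours.

   Any s vertices of D have few common neighbours, since otherwise A could be
   mapped to them and B to the common neighbours; and no V_i contains a matching
   with |T|^2 edges, as one could put A and B in two other classes (p >= 3) and
   use a separate matching edge for each edge of T.  Counting non-adjacent pairs
   then forces |D| = s-1 and makes D adjacent to almost everything.  Now a single
   edge inside a class (i), or two of them (ii), completes a copy of L in which
   A minus one vertex goes to D.  Equality in the count determines G.

   Conversely, in a copy of L in H(n,p,s) the s-1 universal vertices must meet
   every clique, and so give a vertex cover of T with s-1 vertices; with the extra
   edge all cliques but one must be met, which is impossible in (ii) because a
   forest on k vertices has fewer than k edges. *)

Set Implicit Arguments.
Unset Strict Implicit.
Unset Printing Implicit Defensive.

(** * Neighbourhoods *)

Definition nbhd (G : sgraph) (x : G) : {set G} := [set y | x -- y].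

Definition common (G : sgraph) (Z : {set G}) : {set G} := [set v | Z \subset nbhd v].

Definition clique (G : sgraph) (S : {set G}) : Prop :=
  {in S &, forall x y, x != y -> x -- y}.

Section Basics.
Variable G : sgraph.
Implicit Types (x y : G) (X Y Z U F K S : {set G}).

Lemma in_nbhd x y : (y \in nbhd x) = (x -- y).
Proof. by rewrite inE. Qed.

Lemma edgeC x y : (x -- y) = (y -- x).
Proof. exact: sedge_sym. Qed.

Lemma edge_neq x y : x -- y -> x != y.
Proof. by apply: contraTneq => ->; rewrite sedge_irrefl. Qed.

Lemma commonP Z v : reflect (forall x, x \in Z -> x -- v) (v \in common Z).
Proof.
rewrite inE; apply: (iffP subsetP) => h x /h; rewrite in_nbhd 1?edgeC //.
Qed.

Lemma common1 x : common [set x] = nbhd x.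
Proof. by apply/setP=> y; rewrite !inE sub1set in_nbhd edgeC. Qed.

Lemma commonU Y Z : common (Y :|: Z) = common Y :&: common Z.
Proof. by apply/setP=> y; rewrite !inE subUset. Qed.

(** There are only [2 ^ #|K|] traces. Vertices with a common trace [S] are all adjacent to all of
    [S], which is how complete multipartite pieces are extracted below. *)
Lemma trace_pigeonhole a Y K : a * 2 ^ #|K| < #|Y| ->
  exists2 S : {set G}, S \subset K & a < #|[set v in Y | nbhd v :&: K == S]|.
Proof.
move=> lt_Y.
have [/existsP[S /andP[sSK ltS]]|/existsPn none] := boolP [exists S : {set G},
  (S \subset K) && (a < #|[set v in Y | nbhd v :&: K == S]|)]; first by exists S.
suff: #|Y| <= a * 2 ^ #|K| by rewrite leqNgt lt_Y.
rewrite -card_powerset -sum1_card.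
rewrite (partition_big (fun v => nbhd v :&: K) (mem (powerset K))) /=; last first.
  by move=> v _; rewrite inE subsetIr.
rewrite mulnC -sum_nat_const leq_sum // => S; rewrite inE => sSK.
have := none S; rewrite sSK /= -leqNgt; apply: leq_trans.
by rewrite -sum1_card; apply/eq_leq/eq_bigl => v; rewrite inE.
Qed.

Lemma card_setI_sum (T : finType) (A B : {set T}) :
  #|A :&: B| = \sum_(x in A) (x \in B).
Proof.
rewrite -sum1_card big_mkcond [RHS]big_mkcond; apply: eq_bigr => x _.
by rewrite inE; case: (x \in A); case: (x \in B).
Qed.

Lemma double_count X Y :
  \sum_(x in X) #|Y :&: nbhd x| = \sum_(y in Y) #|X :&: nbhd y|.
Proof.
under eq_bigr => x _ do rewrite card_setI_sum.
rewrite exchange_big /=; apply: eq_bigr => y _; rewrite card_setI_sum.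
by apply: eq_bigr => x _; rewrite !in_nbhd edgeC.
Qed.

Lemma double_countN X Y :
  \sum_(x in X) #|Y :\: nbhd x| = \sum_(y in Y) #|X :\: nbhd y|.
Proof.
under eq_bigr => x _ do rewrite setDE card_setI_sum.
rewrite exchange_big /=; apply: eq_bigr => y _; rewrite setDE card_setI_sum.
by apply: eq_bigr => x _; rewrite !inE edgeC.
Qed.

Lemma card_bigcup_le (I T : finType) (P : pred I) (F : I -> {set T}) :
  #|\bigcup_(i | P i) F i| <= \sum_(i | P i) #|F i|.
Proof.
elim/big_ind2: _ => [|A a B b leA leB|//]; first by rewrite cards0.
exact: leq_trans (leq_card_setU _ _) (leq_add leA leB).
Qed.

(** Union bound: a vertex of [U] outside [common Z] is missed by some [x] in [Z], and each [x]
    accounts for at most [w] of them. *)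
Lemma card_common U Z w : (forall x, x \in Z -> #|U :\: nbhd x| <= w) ->
  #|U| <= #|U :&: common Z| + #|Z| * w.
Proof.
move=> hw; rewrite -(cardsID (common Z) U) leq_add2l.
apply: (@leq_trans (\sum_(x in Z) #|U :\: nbhd x|)); last first.
  by rewrite -sum_nat_const leq_sum.
apply: leq_trans (card_bigcup_le _ _); apply/subset_leq_card/subsetP => u.
rewrite !inE => /andP[/subsetPn[x xZ nux] uU]; apply/bigcupP; exists x => //.
by rewrite !inE uU andbT edgeC -in_nbhd.
Qed.

Lemma cliqueU X Y : clique X -> clique Y ->
  (forall x y, x \in X -> y \in Y -> x != y -> x -- y) -> clique (X :|: Y).
Proof.
move=> cX cY cXY x y /setUP[xX|xY] /setUP[yX|yY] nxy; [exact: cX| exact: cXY| |exact: cY].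
by rewrite edgeC; apply: cXY => //; rewrite eq_sym.
Qed.

Lemma clique1 x : clique [set x].
Proof. by move=> y z /set1P-> /set1P->; rewrite eqxx. Qed.

(** Greedy choice of one vertex in each class of [J]: earlier choices exclude at most [z] vertices
    each, and [F] is the set to avoid. *)
Lemma clique_extension (I : finType) (U : I -> {set G}) z (J : {set I}) Z F :
  {in J, forall j, #|J| * z + #|F| < #|U j :&: common Z|} ->
  (forall i j u, i != j -> u \in U i -> #|U j :\: nbhd u| <= z) ->
  exists X, [/\ #|X| = #|J|, [disjoint X & F], clique X & X \subset common Z].
Proof.
(* Recording that [X] lies in the classes of [K] lets [hU] bound what the vertices of [X] exclude
   from the next class. *)
move=> hJ hU; pose P (K : {set I}) := K \subset J -> exists X,
  [/\ #|X| = #|K|, [disjoint X & F], clique X, X \subset common Z &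
     X \subset \bigcup_(i in K) U i].
suff /(_ J (subxx J))[X [? ? ? ? _]] : forall K : {set I}, P K by exists X.
move=> K; have [n] := ubnP #|K|; elim: n K => // n IH K leKn sKJ.
have [->|[k kK]] := set_0Vmem K.
  exists set0; rewrite !cards0; split=> //; try exact: sub0set.
    by rewrite -setI_eq0 set0I.
  by move=> x y; rewrite inE.
have cK := cardsD1 k K; rewrite kK in cK.
have [||X [cX dX clX XZ XU]] := IH (K :\ k).
- by lia.
- exact: subset_trans (subsetDl _ _) sKJ.
have kJ := subsetP sKJ _ kK.
have leX : #|U k :&: common Z| <= #|(U k :&: common Z) :&: common X| + #|X| * z.
  apply: card_common => x /(subsetP XU) /bigcupP[i /setD1P[nik _] xU].
  by apply: leq_trans (hU _ k _ nik xU); apply/subset_leq_card/setSD/subsetIl.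
have lt0 : 0 < #|(U k :&: common Z :&: common X) :\: F|.
  have := subset_leq_card (subsetIr (U k :&: common Z :&: common X) F).
  have := cardsID F (U k :&: common Z :&: common X).
  have : #|X| * z <= #|J| * z by rewrite leq_mul2r; have := subset_leq_card sKJ; lia.
  by have := hJ k kJ; lia.
have /card_gt0P[y] := lt0; rewrite !in_setD !in_setI -!andbA => /and4P[yF yU yZ yX].
have nyX : y \notin X.
  by apply/negP => /(commonP _ _ yX); rewrite sedge_irrefl.
exists (y |: X); split.
- by rewrite cardsU1 nyX cX cK.
- by rewrite disjoints_subset subUset sub1set inE yF -disjoints_subset.
- apply: cliqueU => //; first exact: clique1.
  by move=> x x' /set1P-> x'X _; rewrite edgeC; apply: (commonP _ _ yX).
- by rewrite subUset sub1set yZ.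
- rewrite subUset sub1set; apply/andP; split; first by apply/bigcupP; exists k.
  by apply: subset_trans XU _; apply/bigcupsP => i /setD1P[_ iK]; apply: (bigcup_sup i).
Qed.

End Basics.

(** * Embedding blow-ups *)

Lemma edgesP (G : sgraph) (e : {set G}) :
  reflect (exists x y, x -- y /\ e = [set x; y]) (e \in edges G).
Proof.
apply: (iffP imset2P) => [[x y _]|[x [y [xy ->]]]]; last by exists x y; rewrite // inE.
by rewrite inE => /andP[_ xy] ->; exists x, y.
Qed.

Lemma bipartition_edge (G : sgraph) (A B : {set G}) x y : bipartition A B ->
  x -- y -> (x \in A) && (y \in B) || (x \in B) && (y \in A).
Proof.
move=> [AB _ /forall_inP iA /forall_inP iB] xy.
have in_AB z : (z \in A) || (z \in B) by rewrite -in_setU AB inE.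
have nA : ~~ ((x \in A) && (y \in A)).
  by apply/negP => /andP[/iA/forall_inP h /h]; rewrite xy.
have nB : ~~ ((x \in B) && (y \in B)).
  by apply/negP => /andP[/iB/forall_inP h /h]; rewrite xy.
by move: (in_AB x) (in_AB y) nA nB; do 4!case: (_ \in _).
Qed.

Lemma bipartitionN (G : sgraph) (A B : {set G}) x : bipartition A B ->
  (x \in B) = (x \notin A).
Proof.
move=> [AB dAB _ _]; have: x \in A :|: B by rewrite AB inE.
by rewrite inE; case xA: (x \in A) => //= _; rewrite (disjointFr dAB xA).
Qed.

Section Embed.
Variables (T G : sgraph) (A B : {set T}) (p : nat).
Hypothesis hAB : bipartition A B.

Lemma contains_blowup (f : T -> G) (h : T -> T -> {set G}) :
  injective f -> (forall x y, x -- y -> f x -- f y) ->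
  (forall a b, a \in A -> b \in B -> a -- b ->
     [/\ #|h a b| = p - 1, clique (f a |: (f b |: h a b)) & forall x, f x \notin h a b]) ->
  (forall a b a' b', a \in A -> b \in B -> a -- b -> a' \in A -> b' \in B -> a' -- b' ->
     (a, b) != (a', b') -> [disjoint h a b & h a' b']) ->
  contains G (blowup T p.+1).
Proof.
move=> finj fhom hh hdis.
(* Each edge of [T] is read as a pair from [A] to [B], so that [h] is evaluated in one direction
   only. *)
pose Q (e : edge_type T) (ab : T * T) :=
  [&& ab.1 \in A, ab.2 \in B, ab.1 -- ab.2 & val e == [set ab.1; ab.2]].
have exQ e : exists ab, Q e ab.
  case: e => e /=; rewrite /Q /= => /edgesP[x [y [xy ->]]].
  case/orP: (bipartition_edge hAB xy) => /andP[h1 h2].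
    by exists (x, y); rewrite /= h1 h2 xy eqxx.
  by exists (y, x); rewrite /= h1 h2 edgeC xy setUC eqxx.
pose en e := xchoose (exQ e).
have enP e : Q e (en e) := xchooseP (exQ e).
pose H e := h (en e).1 (en e).2.
have HP e : [/\ #|H e| = p - 1, clique (f (en e).1 |: (f (en e).2 |: H e)) &
    forall x, f x \notin H e].
  by have /and4P[? ? ? _] := enP e; apply: hh.
have Hdis e e' : e != e' -> [disjoint H e & H e'].
  move=> nee; have /and4P[? ? ? /eqP ee] := enP e; have /and4P[? ? ? /eqP ee'] := enP e'.
  apply: hdis => //; apply: contraNneq nee => E; apply/eqP/val_inj.
  by rewrite ee ee'; case: E => -> ->.
pose g (v : blowup T p.+1) : G := match v with
  | inl x => f x
  | inr (e, i) => nth (f (en e).1) (enum (H e)) i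
  end.
have gH e i : g (inr (e, i)) \in H e.
  rewrite /= -mem_enum mem_nth // -cardE; have [-> _ _] := HP e.
  exact: (ltn_ord i).
have ltH e (i : 'I_(p.+1 - 2)) : i < size (enum (H e)).
  by rewrite -cardE; have [-> _ _] := HP e; exact: (ltn_ord i).
have ginr e i j : g (inr (e, i)) = g (inr (e, j)) -> i = j.
  move/eqP; rewrite /= nth_uniq ?enum_uniq ?ltH //.
  by move/eqP/val_inj.
exists g.
  move=> [x|[e i]] [y|[e' j]].
  - by move/finj->.
  - by move=> E; have [_ _ /(_ x)/negP[]] := HP e'; have := gH e' j; rewrite -E.
  - by move=> E; have [_ _ /(_ y)/negP[]] := HP e; have := gH e i; rewrite E.
  - move=> E; have [ee|/Hdis d] := eqVneq e e'; first by subst e'; rewrite (ginr _ _ _ E).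
    by have := disjointFr d (gH e i); rewrite E gH.
have fin (e : edge_type T) x : x \in val e -> f x \in [set f (en e).1; f (en e).2].
  by have /and4P[_ _ _ /eqP->] := enP e; rewrite !inE => /orP[] /eqP->; rewrite eqxx ?orbT.
have mixed (e : edge_type T) i x : x \in val e -> f x -- g (inr (e, i)).
  move=> xe; have [_ cl nf] := HP e; apply: cl.
  - by have := fin e x xe; rewrite !inE => /orP[]->; rewrite ?orbT.
  - by rewrite !in_setU gH !orbT.
  - by apply: contraNneq (nf x) => ->; apply: gH.
move=> [x|[e i]] [y|[e' j]].
- exact: fhom.
- exact: mixed.
- by move=> /= xe; rewrite edgeC; apply: mixed.
- move=> /andP[/eqP ee nij]; subst e'; have [_ cl _] := HP e.
  apply: cl; rewrite ?in_setU ?gH ?orbT //.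
  by apply: contraNneq nij => /ginr ->.
Qed.

(* [r a b] holds the vertices of the clique of [ab] that are prescribed in
   advance; the others are chosen greedily, one in each class of [J a b]. *)
Lemma greedy_blowup (f : T -> G) (I : finType) (U : I -> {set G}) z
    (r : T -> T -> {set G}) (J : T -> T -> {set I}) :
  0 < p -> injective f ->
  (forall i j u, i != j -> u \in U i -> #|U j :\: nbhd u| <= z) ->
  (forall a b, a \in A -> b \in B -> a -- b ->
     [/\ #|r a b| + #|J a b| = p - 1, clique (f a |: (f b |: r a b)), forall x, f x \notin r a b &
       {in J a b, forall j, p * z + #|T| + 2 * #|T| ^ 2 * p <
          #|U j :&: common (f a |: (f b |: r a b))|}]) ->
  (forall a b a' b', a \in A -> b \in B -> a -- b -> a' \in A -> b' \in B -> a' -- b' ->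
     (a, b) != (a', b') -> [disjoint r a b & r a' b']) ->
  contains G (blowup T p.+1).
Proof.
move=> p0 finj hU hr rdis.
pose Q (ab : T * T) := [&& ab.1 \in A, ab.2 \in B & ab.1 -- ab.2].
pose R ab := r ab.1 ab.2.
(* No greedy choice may use these: the image of [T] and all prescribed vertices, including those of
   edges handled later. *)
pose F0 := [set f x | x in T] :|: \bigcup_(ab | Q ab) R ab.
have leR ab : Q ab -> #|R ab| <= p.
  by move=> /and3P[h1 h2 h3]; have [] := hr _ _ h1 h2 h3; rewrite /R; lia.
have cTT : #|{: T * T}| = #|T| ^ 2 by rewrite card_prod mulnn.
have sumle (P : pred (T * T)) (F : T * T -> {set G}) :
    (forall ab, P ab -> #|F ab| <= p) -> #|\bigcup_(ab | P ab) F ab| <= #|T| ^ 2 * p.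
  move=> hF; apply: leq_trans (card_bigcup_le _ _) _.
  apply: (@leq_trans (\sum_(ab | P ab) p)); first exact: leq_sum.
  by rewrite sum_nat_const leq_mul2r -cTT max_card orbT.
have leF0 : #|F0| <= #|T| + #|T| ^ 2 * p.
  apply: leq_trans (leq_card_setU _ _) _; apply: leq_add; last exact: sumle.
  exact: leq_imset_card.
pose good (h : T * T -> {set G}) ab :=
  [/\ #|h ab| = p - 1, clique (f ab.1 |: (f ab.2 |: h ab)), R ab \subset h ab &
      [disjoint h ab :\: R ab & F0]].
(* Induction over the edges: a new clique avoids [F0], apart from its own prescribed vertices, and
   the cliques completed so far. *)
have key (s : seq (T * T)) : uniq s -> all Q s -> exists h : T * T -> {set G},
    (forall ab, ab \in s -> good h ab) /\
    (forall ab ab', ab \in s -> ab' \in s -> ab != ab' -> [disjoint h ab & h ab']).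
  elim: s => [|ab s IH]; first by exists (fun=> set0).
  move=> /= /andP[abs us] /andP[Qab Qs]; have [h [hg hd]] := IH us Qs.
  pose F := F0 :|: \bigcup_(xy | xy \in s) h xy.
  have /and3P[h1 h2 h3] := Qab; have [rJ clr fr hJ] := hr _ _ h1 h2 h3.
  have [||X [cX dX clX XZ]] := @clique_extension G I U z (J ab.1 ab.2)
    (f ab.1 |: (f ab.2 |: R ab)) F.
  - move=> j jJ; apply: leq_trans _ (hJ j jJ); rewrite ltnS -addnA.
    apply: leq_add; first by rewrite leq_mul2r; move: rJ; clear; lia.
    apply: leq_trans (leq_card_setU _ _) _.
    have /sumle hs : forall xy, xy \in s -> #|h xy| <= p.
      by move=> xy /hg[-> _ _ _]; apply: leq_subr.
    by apply: leq_trans (leq_add leF0 hs) _; rewrite -addnA leq_add2l addnn -mul2n mulnA.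
  - exact: hU.
  have XF x : x \in X -> x \notin F by move=> xX; rewrite (disjointFr dX xX).
  have RX : [disjoint R ab & X].
    rewrite disjoint_sym disjoints_subset; apply/subsetP => x /XF; rewrite !inE !negb_or -!andbA.
    move=> /and3P[_ nb _]; apply: contra nb => xR; apply/bigcupP; by exists ab.
  pose h' xy := if xy == ab then R ab :|: X else h xy.
  have dnew xy : xy \in s -> [disjoint R ab :|: X & h xy].
    move=> xys; have nab : xy != ab by apply: contraNneq abs => <-.
    rewrite -setI_eq0 setIUl setU_eq0 !setI_eq0; apply/andP; split; last first.
      rewrite disjoints_subset; apply/subsetP => x /XF; rewrite !inE !negb_or => /andP[_].
      by apply: contra => xh; apply/bigcupP; exists xy.
    have [_ _ Rh dh] := hg _ xys.
    have Qxy := allP Qs _ xys; have /and3P[k1 k2 k3] := Qxy.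
    rewrite disjoints_subset; apply/subsetP => x xR; rewrite inE; apply/negP => xh.
    case xR': (x \in R xy).
      have d : [disjoint R ab & R xy].
        by apply: rdis => //; rewrite -!surjective_pairing eq_sym.
      by rewrite (disjointFr d xR) in xR'.
    have : x \in h xy :\: R xy by rewrite inE xR' xh.
    move/(disjointFr dh); rewrite inE => /negbT; rewrite negb_or => /andP[_ /negP[]].
    by apply/bigcupP; exists ab.
  exists h'; split.
    move=> xy; rewrite inE; have [->|nxy] /= := eqVneq xy ab; last first.
      by move=> /hg; rewrite /good /h' (negPf nxy).
    move=> _; rewrite /good /h' eqxx; split.
    - rewrite cardsU (disjoint_setI0 RX) cards0 subn0 cX; exact: rJ.
    - rewrite !setUA -[f ab.1 |: _ :|: R ab]setUA; apply: cliqueU => //.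
      by move=> x y xZ yX _; apply: (commonP _ _ (subsetP XZ _ yX)).
    - exact: subsetUl.
    - rewrite disjoints_subset; apply/subsetP => x; rewrite !inE.
      case xR: (x \in R ab) => //= /XF; rewrite !inE !negb_or -!andbA => /and3P[-> ->] //.
  move=> xy xy'; rewrite !inE /h'.
  have [->|nxy] /= := eqVneq xy ab; have [->|nxy'] /= := eqVneq xy' ab; rewrite ?eqxx //.
  - by move=> _ /dnew.
  - by move=> /dnew; rewrite disjoint_sym.
  - exact: hd.
have [|h [hg hd]] := key (enum Q) (enum_uniq _).
  by apply/allP => ab; rewrite mem_enum.
have inQ a b : a \in A -> b \in B -> a -- b -> (a, b) \in enum Q.
  by move=> aA bB ab; rewrite mem_enum /in_mem /= /Q /= aA bB ab.
apply: (@contains_blowup f (fun a b => h (a, b))) => //.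
- move=> x y xy; case/orP: (bipartition_edge hAB xy) => /andP[h1 h2].
    have [_ cl _ _] := hr x y h1 h2 xy.
    by apply: cl; rewrite ?inE ?eqxx ?orbT // (inj_eq finj) edge_neq.
  rewrite edgeC in xy *; have [_ cl _ _] := hr y x h2 h1 xy.
  by rewrite edgeC; apply: cl; rewrite ?inE ?eqxx ?orbT // (inj_eq finj) edge_neq.
- move=> a b aA bB ab; have [c1 c2 c3 c4] := hg _ (inQ a b aA bB ab); split=> // x.
  have [_ _ fr _] := hr a b aA bB ab.
  apply/negP => xh; have : f x \in h (a, b) :\: R (a, b) by rewrite inE fr xh.
  by move/(disjointFr c4); rewrite inE imset_f.
- by move=> a b a' b' *; apply: hd => //; apply: inQ.
Qed.

End Embed.

Lemma injection_into (T R : finType) (y0 : R) (S : {set T}) (Y : {set R}) :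
  #|S| <= #|Y| -> exists g : T -> R, {in S &, injective g} /\ {in S, forall x, g x \in Y}.
Proof.
move=> leSY; pose g x := nth y0 (enum Y) (index x (enum S)).
have lt x : x \in S -> index x (enum S) < size (enum Y).
  by move=> xS; rewrite -cardE; apply: leq_trans leSY; rewrite cardE index_mem mem_enum.
exists g; split=> [x y xS yS /eqP|x xS]; last by rewrite -mem_enum mem_nth ?lt.
rewrite nth_uniq ?lt ?enum_uniq // => /eqP E.
by rewrite -[x](nth_index x (s := enum S)) ?mem_enum // E nth_index ?mem_enum.
Qed.

(** Greedy: each vertex outside [A] has [#|T|] candidates, and fewer than [#|T|] images are taken
    before its turn. *)
Lemma extend_injection (T R : finType) (A : {set T}) (g : T -> R) (cand : T -> {set R}) :
  {in A &, injective g} -> (forall t, t \notin A -> #|T| <= #|cand t|) ->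
  exists f : T -> R, [/\ injective f, {in A, f =1 g} & forall t, t \notin A -> f t \in cand t].
Proof.
move=> ginj hc; suff key k (S : {set T}) : A \subset S -> #|S| = #|A| + k ->
    exists f : T -> R, [/\ {in S &, injective f}, {in A, f =1 g} &
      forall t, t \in S -> t \notin A -> f t \in cand t].
  have [||f [f1 f2 f3]] := key (#|T| - #|A|) setT; rewrite ?subsetT ?cardsT //.
    by rewrite subnKC // max_card.
  by exists f; split=> // [x y|t]; [apply: f1|apply: f3]; rewrite inE.
elim: k S => [|k IH] S sAS cS.
  exists g; have <- : A = S by apply/eqP; rewrite eqEcard sAS cS addn0 /=.
  by split=> // t ->.
have /subsetPn[t tS tA] : ~~ (S \subset A).
  by apply/negP => /subset_leq_card; rewrite cS; lia.
have cSt := cardsD1 t S; rewrite tS in cSt.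
have [||f [f1 f2 f3]] := IH (S :\ t).
- by rewrite subsetD1 sAS.
- by lia.
have : 0 < #|cand t :\: (f @: (S :\ t))|.
  have := cardsID (f @: (S :\ t)) (cand t).
  have := subset_leq_card (subsetIr (cand t) (f @: (S :\ t))).
  have := leq_imset_card f (S :\ t); have := hc t tA; have := max_card S; lia.
case/card_gt0P => y /setDP[yc yf].
have nf x : x \in S -> x != t -> f x != y.
  by move=> xS nx; apply: contraNneq yf => <-; apply: imset_f; rewrite !inE nx.
exists (fun x => if x == t then y else f x); split.
- move=> x x' xS x'S; have [->|nx] := eqVneq x t; have [->|nx'] := eqVneq x' t => //.
  + by move=> E; have := nf x' x'S nx'; rewrite E eqxx.
  + by move/eqP; rewrite (negPf (nf x xS nx)).
  + by apply: f1; rewrite !inE ?nx ?nx'.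
- by move=> x xA; case: eqVneq => [E|_]; [rewrite -E xA in tA|apply: f2].
- by move=> x xS xA; case: eqVneq => [->|nx] //; apply: f3; rewrite ?inE ?nx.
Qed.

Section EmbedA.
Variables (T G : sgraph) (A B : {set T}) (p : nat).
Hypotheses (hAB : bipartition A B) (p_gt0 : 0 < p).

(** Bounds the vertices of a class lost in the greedy construction: [p * z] to vertices already
    chosen for the same clique, [#|T|] to the image of [T], and [#|T| ^ 2 * p] each to the
    prescribed vertices and to the completed cliques. *)
Definition room z := p * z + #|T| + 2 * #|T| ^ 2 * p.

(** The common form of all copies built below: [A] is placed by [g], then [B] injectively, each [b]
    in [cand b]. The conditions are asked of every candidate because the choice is left to
    [extend_injection]. *)
Lemma blowup_from_A (g : T -> G) (cand : T -> {set G}) (I : finType) (U : I -> {set G}) z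
    (r : T -> T -> {set G}) (J : T -> T -> {set I}) :
  {in A &, injective g} ->
  (forall b, b \in B -> #|T| <= #|cand b|) ->
  (forall i j u, i != j -> u \in U i -> #|U j :\: nbhd u| <= z) ->
  (forall a b, a \in A -> b \in B -> a -- b ->
     [/\ #|r a b| + #|J a b| = p - 1, clique (g a |: r a b), 
       (forall x, x \in A -> g x \notin r a b), 
       (forall b', b' \in B -> [disjoint r a b & cand b']) & 
       forall y, y \in cand b -> y \in common (g a |: r a b) /\
         {in J a b, forall j, room z < #|U j :&: common (g a |: (y |: r a b))|}]) ->
  (forall a b a' b', a \in A -> b \in B -> a -- b -> a' \in A -> b' \in B -> a' -- b' ->
     (a, b) != (a', b') -> [disjoint r a b & r a' b']) ->
  contains G (blowup T p.+1).
Proof.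
move=> ginj hc hU hr rdis.
have [|f [f1 f2 f3]] := @extend_injection T G A g cand ginj.
  by move=> t tA; apply: hc; rewrite (bipartitionN t hAB).
apply: (greedy_blowup (J := J) hAB p_gt0 f1 hU _ rdis) => a b aA bB ab.
have [r1 r2 r3 r4 r5] := hr a b aA bB ab.
have nbA : b \notin A by rewrite -(bipartitionN b hAB).
have [fb1 fb2] := r5 _ (f3 b nbA).
rewrite (f2 a aA); split=> //.
- have -> : g a |: (f b |: r a b) = [set f b] :|: (g a |: r a b).
    by rewrite !setUA [[set g a] :|: _]setUC.
  apply: cliqueU => //; first exact: clique1.
  by move=> x y /set1P-> yr _; rewrite edgeC; apply: (commonP _ _ fb1).
- move=> x; case xA: (x \in A); first by rewrite f2 ?r3.
  have xB : x \in B by rewrite (bipartitionN x hAB) xA.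
  have/disjointFl -> // := r4 _ xB.
  by apply: f3; rewrite xA.
Qed.

(** No vertex is prescribed: [A] goes into [D], [B] into [Y], and each clique takes one further
    vertex from every class other than [i]. *)
Lemma blowup_from_star (I : finType) (U : I -> {set G}) z (i : I) (D Y : {set G}) :
  #|I| = p -> (forall i j u, i != j -> u \in U i -> #|U j :\: nbhd u| <= z) ->
  #|A| <= #|D| -> #|T| <= #|Y| -> 0 < #|T| ->
  {in D & Y, forall d y, d -- y /\
     forall j, j != i -> room z < #|U j :&: (nbhd d :&: nbhd y)|} ->
  contains G (blowup T p.+1).
Proof.
move=> cI hU AD TY T0 DY.
have /card_gt0P[y0 y0Y] : 0 < #|Y| by lia.
have [g [g1 g2]] := injection_into y0 AD.
apply: (@blowup_from_A g (fun=> Y) I U z (fun _ _ => set0) (fun _ _ => [set~ i])) => //.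
- move=> a b aA bB ab; rewrite cards0 add0n setU0 cardsC1 cI; split.
  + by rewrite subn1.
  + exact: clique1.
  + by move=> x _; rewrite inE.
  + by move=> b' _; rewrite -setI_eq0 set0I.
  + move=> y yY; have [dy hj] := DY _ _ (g2 a aA) yY; split.
      by rewrite common1 in_nbhd.
    by move=> j; rewrite !inE setU0 commonU !common1; apply: hj.
- by move=> *; rewrite -setI_eq0 set0I.
Qed.

End EmbedA.

(** * Stability under a minimum degree condition *)

Definition some_subset (T : finType) (m : nat) (S : {set T}) : {set T} :=
  [set x in take m (enum S)].

Lemma some_subset_sub (T : finType) m (S : {set T}) : some_subset m S \subset S.
Proof. by apply/subsetP => x; rewrite inE => /mem_take; rewrite mem_enum. Qed.

Lemma card_some_subset (T : finType) m (S : {set T}) :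
  m <= #|S| -> #|some_subset m S| = m.
Proof.
move=> le_m; rewrite cardsE (card_uniqP _) ?take_uniq ?enum_uniq //.
by rewrite size_takel -?cardE.
Qed.

(** The Erdős-Stone induction on [r]: among the vertices with [M] neighbours in each of [r] larger
    classes, many have the same trace. They form the next class, and the old classes shrink to this
    trace. *)
Lemma multipartite_of_min_degree p r M : 0 < M -> r <= p -> exists n0, forall (G : sgraph) c,
  n0 <= #|G| -> (forall v : G, #|~: nbhd v| <= c) -> p * c <= #|G| + p ->
  exists C : nat -> {set G}, (forall i, i < r -> #|C i| = M) /\
    (forall i j x y, i < r -> j < r -> i != j -> x \in C i -> y \in C j -> x -- y).
Proof.
elim: r M => [|r IH] M M0 ltrp; first by exists 0 => G c _ _ _; exists (fun=> set0).
(* This factor leaves a positive proportion of the vertices in [Good]: counting non-adjacent pairs,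
   at most about a fraction [(2 * p - 2) / (2 * p - 1)] of them miss more than [M' - M] of some
   class. *)
pose M' := 2 * p * M.
have [||n1 Hn1] := IH M'; [by rewrite /M' !muln_gt0 M0 (leq_ltn_trans _ ltrp) | exact: ltnW |].
exists (maxn n1 (2 * p * (M * 2 ^ (p * M') + 1) + 2 * p * p)) => G c.
rewrite geq_max => /andP[n1G leG] hc hpc.
have [C [cC adjC]] := Hn1 G c n1G hc hpc.
pose K := \bigcup_(i < r) C i.
have leK : #|K| <= p * M'.
  apply: leq_trans (card_bigcup_le _ _) _.
  under eq_bigr => i _ do rewrite cC //.
  by rewrite sum_nat_const card_ord leq_mul2r (ltnW ltrp) orbT.
pose Good := [set v | [forall i : 'I_r, M <= #|C i :&: nbhd v|]].
have leBad : (M' - M) * #|~: Good| <= r * M' * c.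
  apply: (@leq_trans (\sum_(v in ~: Good) \sum_(i < r) #|C i :\: nbhd v|)).
    rewrite mulnC -sum_nat_const; apply: leq_sum => v.
    rewrite !inE => /forallPn[i]; rewrite -ltnNge => lt_i.
    rewrite (bigD1 i) //=; apply: leq_trans (leq_addr _ _).
    have := cardsID (nbhd v) (C i); rewrite cC //; lia.
  apply: (@leq_trans (\sum_v \sum_(i < r) #|C i :\: nbhd v|)).
    by rewrite [leqRHS](bigID (mem (~: Good))) leq_addr.
  rewrite exchange_big /= -[r in leqRHS]card_ord -mulnA -sum_nat_const.
  apply: leq_sum => i _; rewrite -(cC i) // -sum_nat_const.
  have := double_countN setT (C i); under eq_bigl => v do rewrite inE.
  by move=> ->; apply: leq_sum => x _; rewrite setTD.
have ltGood : M * 2 ^ #|K| < #|Good|.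
  have leX : 2 ^ #|K| <= 2 ^ (p * M') by rewrite leq_exp2l.
  have := cardsC Good; rewrite -cardsT in leG hpc *.
  move: leX leBad hpc leG; rewrite /M' !cardsT.
  move: (2 ^ #|K|) (2 ^ (p * _)) #|G| #|Good| #|~: Good| => k k' n g b leX leBad hpc leG E.
  have h1 : (2 * p - 1) * b <= r * (2 * p) * c.
    rewrite -(leq_pmul2l M0); move: leBad; rewrite -[X in _ - X]mul1n -mulnBl.
    by move: (2 * p - 1) => x; lia.
  have h2 : (2 * p - 1) * b <= (2 * p - 2) * (n + p).
    apply: leq_trans h1 _; apply: (@leq_trans ((2 * p - 2) * (p * c))); last first.
      by rewrite leq_mul2l hpc orbT.
    rewrite -(mulnBr 2 p 1) -!mulnA [r * _]mulnCA leq_mul2l /= leq_mul2r.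
    by rewrite subn1 -ltnS prednK ?ltrp ?orbT // (leq_ltn_trans _ ltrp).
  have h3 : n <= (2 * p - 1) * g + 2 * p * p.
    have p1 : 2 * p - 1 = (2 * p - 2).+1 by lia.
    have xp : (2 * p - 2) * p <= 2 * p * p by rewrite leq_mul2r leq_subr orbT.
    by move: h2 xp; rewrite p1 -E; move: (2 * p - 2) => x; lia.
  have h4 : 2 * p * (M * k' + 1) <= 2 * p * g.
    apply: (@leq_trans ((2 * p - 1) * g)); last by rewrite leq_mul2r leq_subr orbT.
    by move: h3 leG; clear; lia.
  have p0 : 0 < 2 * p by rewrite muln_gt0 (leq_ltn_trans _ ltrp).
  rewrite (leq_pmul2l p0) addn1 in h4; apply: leq_ltn_trans h4.
  by rewrite leq_mul2l leX orbT.
have [S sSK ltS] := trace_pigeonhole ltGood.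
pose Y := [set v in Good | nbhd v :&: K == S].
have SC i v : i < r -> v \in Y -> S :&: C i = C i :&: nbhd v.
  move=> ir; rewrite inE => /andP[_ /eqP<-]; rewrite -setIA setIC.
  by congr (_ :&: _); apply/setIidPr/(bigcup_sup (Ordinal ir)).
exists (fun i => if i < r then some_subset M (S :&: C i) else some_subset M Y); split.
  move=> i _; case: ifP => ir; last by apply: card_some_subset; apply: ltnW.
  apply: card_some_subset; have /card_gt0P[v vY] : 0 < #|Y| by apply: leq_trans ltS.
  rewrite (SC i v ir vY); move: vY; rewrite !inE => /andP[/forallP h _].
  exact: (h (Ordinal ir)).
have adjY i x y : i < r -> x \in some_subset M (S :&: C i) -> y \in some_subset M Y -> x -- y.
  move=> ir /(subsetP (some_subset_sub _ _)) xS /(subsetP (some_subset_sub _ _)) yY.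
  by move: xS; rewrite (SC i y ir yY) inE in_nbhd edgeC => /andP[].
move=> i j x y; rewrite !ltnS => ir jr nij.
case: (ltnP i r) => hi; case: (ltnP j r) => hj.
- move=> /(subsetP (some_subset_sub _ _)) xS /(subsetP (some_subset_sub _ _)) yS.
  by move: xS yS; rewrite !inE => /andP[_ xC] /andP[_ yC]; apply: (adjC i j).
- exact: adjY.
- by move=> *; rewrite edgeC; apply: (adjY j).
- by move: nij; rewrite (_ : i = j) ?eqxx //; lia.
Qed.

(** [X] is one more part besides the [p] sets [C i], so there are [p + 1] parts. *)
Definition has_complete_multipartite (G : sgraph) (p t : nat) : Prop :=
  exists (X : {set G}) (C : 'I_p -> {set G}),
  [/\ t <= #|X|, forall i, t <= #|C i|, forall i, {in X & C i, forall x y, x -- y} &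
      forall i j, i != j -> {in C i & C j, forall x y, x -- y}].

Section Stability.
Variable G : sgraph.

(** A Kővári-Sós-Turán count: many vertices of [W] have [t] neighbours in [X], and many of those
    share their trace on [X]. *)
Lemma complete_pair_of_dense (t k : nat) (W X : {set G}) :
  {in X, forall x, k <= #|W :&: nbhd x|} ->
  t * #|W| + #|X| * (t * 2 ^ #|X|) < #|X| * k ->
  exists S Y : {set G}, [/\ S \subset X, Y \subset W, #|S| = t, #|Y| = t &
    {in S & Y, forall x y, x -- y}].
Proof.
move=> hX lt; pose Y' := [set y in W | t <= #|X :&: nbhd y|].
have le1 : #|X| * k <= t * #|W| + #|X| * #|Y'|.
  apply: (@leq_trans (\sum_(x in X) #|W :&: nbhd x|)).
    by rewrite -sum_nat_const; apply: leq_sum.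
  rewrite double_count.
  apply: (@leq_trans (\sum_(y in W) (t + #|X| * (y \in Y')))).
    apply: leq_sum => y yW; have -> : (y \in Y') = (t <= #|X :&: nbhd y|) by rewrite inE yW.
    case: (leqP t #|X :&: nbhd y|) => [_|lty].
      by rewrite /= muln1; apply: leq_trans (leq_addl _ _); apply/subset_leq_card/subsetIl.
    by rewrite /= muln0 addn0 ltnW.
  rewrite big_split /= sum_nat_const -big_distrr /= mulnC leq_add2l leq_mul2l.
  by rewrite -card_setI_sum (subset_leq_card (subsetIr _ _)) orbT.
have : t * 2 ^ #|X| < #|Y'|.
  have : #|X| * (t * 2 ^ #|X|) < #|X| * #|Y'| by move: lt le1; lia.
  by rewrite ltn_mul2l => /andP[].
case/trace_pigeonhole => S sSX ltS.
pose Y := [set v in Y' | nbhd v :&: X == S].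
have /card_gt0P[y0 y0Y] : 0 < #|Y| by apply: leq_trans ltS.
have trace y : y \in Y -> S = X :&: nbhd y.
  by rewrite inE => /andP[_ /eqP<-]; rewrite setIC.
exists (some_subset t S), (some_subset t Y); split.
- exact: subset_trans (some_subset_sub _ _) sSX.
- apply: subset_trans (some_subset_sub _ _) _; apply/subsetP => y.
  by rewrite !inE -!andbA => /and3P[].
- by apply: card_some_subset; rewrite (trace _ y0Y); move: y0Y; rewrite !inE -!andbA => /and3P[].
- exact/card_some_subset/ltnW.
- move=> x y /(subsetP (some_subset_sub _ _)) xS /(subsetP (some_subset_sub _ _)) yY.
  by move: xS; rewrite (trace y yY) !inE edgeC => /andP[].
Qed.

Variables (p t y M c : nat) (C : 'I_p -> {set G}).
Hypotheses (t_gt0 : 0 < t) (y_ge : t <= y) (ME : M = 4 * t * y).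
Hypotheses (cC : forall i, #|C i| = M).
Hypothesis adjC : forall i j, i != j -> {in C i & C j, forall x y, x -- y}.
Hypothesis hc : forall v : G, #|~: nbhd v| <= c.
Hypothesis free : ~ has_complete_multipartite G p t.

(** Vertices are sorted by their adjacency to the fixed multipartite graph: [E] could supply a
    further part, [W i] behaves like part [i], and [At] is the atypical rest. *)
Let E := [set v | [forall i, t <= #|C i :&: nbhd v|]].
Let W i := [set v | (#|C i :&: nbhd v| < t) &&
  [forall j, (j != i) ==> (#|C j :\: nbhd v| <= y)]].
Let At := ~: (E :|: \bigcup_i W i).

(** A larger [E] would contain [t] vertices with one trace, and this trace has [t] vertices in every
    [C i], giving [p + 1] parts. *)
Lemma few_dominating : #|E| <= t * 2 ^ (p * M).
Proof.
pose K := \bigcup_i C i.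
have leK : #|K| <= p * M.
  apply: leq_trans (card_bigcup_le _ _) _.
  by under eq_bigr => i _ do rewrite cC //; rewrite sum_nat_const card_ord.
rewrite leqNgt; apply/negP => ltE; apply: free.
have [|S sSK ltS] := @trace_pigeonhole G t E K.
  by apply: leq_ltn_trans ltE; rewrite leq_mul2l leq_exp2l ?leK ?orbT.
pose Y := [set v in E | nbhd v :&: K == S].
have SC i v : v \in Y -> S :&: C i = C i :&: nbhd v.
  rewrite inE => /andP[_ /eqP<-]; rewrite -setIA setIC.
  by congr (_ :&: _); apply/setIidPr/(bigcup_sup i).
have /card_gt0P[v0 v0Y] : 0 < #|Y| by apply: leq_trans ltS.
exists Y, (fun i => S :&: C i); split.
- exact: ltnW.
- by move=> i; rewrite (SC i v0 v0Y); move: v0Y; rewrite !inE => /andP[/forallP].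
- by move=> i x z xY; rewrite (SC i x xY) !inE => /andP[].
- by move=> i j nij x z; rewrite !inE => /andP[_ xC] /andP[_ zC]; apply: (adjC nij).
Qed.

Lemma split_C i v : #|C i :&: nbhd v| + #|C i :\: nbhd v| = M.
Proof. by rewrite cardsID cC. Qed.

Lemma sum_missing (S : {set G}) i : \sum_(v in S) #|C i :\: nbhd v| <= M * c.
Proof.
rewrite double_countN -(cC i) -sum_nat_const; apply: leq_sum => x _.
by apply: leq_trans (hc x); apply/subset_leq_card; rewrite setDE subsetIr.
Qed.

Lemma typical_disjoint i j : i != j -> [disjoint W i & W j].
Proof.
move=> nij; rewrite -setI_eq0 -subset0; apply/subsetP => v; rewrite !inE => /andP[].
case/andP=> lti _ /andP[_ /forallP/(_ i)]; rewrite nij /= => le.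
by have := split_C i v; have : y <= t * y; [rewrite leq_pmull | lia].
Qed.

(** A vertex of [W i] misses more than [M - t] vertices of [C i], whereas each of the [M] vertices
    of [C i] misses at most [c] vertices; so [W i] is hardly larger than [c]. *)
Lemma card_typical i : #|W i| * (M - t) <= M * c.
Proof.
apply: leq_trans (sum_missing (W i) i); rewrite -sum_nat_const; apply: leq_sum => v.
by rewrite inE => /andP[lt _]; have := split_C i v; lia.
Qed.

(** Every vertex outside [E] misses at least [M - t] vertices of one part, and an atypical one
    misses more than [y] of another. As [p * c] hardly exceeds [#|G|], the total leaves little for
    the latter. *)
Lemma card_atypical : (#|G| - #|E|) * (M - t) + y * #|At| <= p * M * c.
Proof.
apply: (@leq_trans (\sum_(v in ~: E) \sum_i #|C i :\: nbhd v|)).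
  have -> : #|G| - #|E| = #|~: E| by rewrite -(cardsC E) addKn.
  have <- : #|~: E :&: At| = #|At|.
    by congr #|pred_of_set _|; apply/setIidPr; rewrite setCS subsetUl.
  rewrite card_setI_sum big_distrr -sum_nat_const -big_split /=.
  apply: leq_sum => v vE.
  have /forallPn[i] : ~~ [forall i, t <= #|C i :&: nbhd v|] by move: vE; rewrite !inE.
  rewrite -ltnNge => lti; rewrite [leqRHS](bigD1 i) //=; apply: leq_add.
    by have := split_C i v; lia.
  case vA: (v \in At); last by rewrite muln0.
  move: vA; rewrite !inE negb_or => /andP[_ /bigcupP nW].
  have : v \notin W i by apply/negP => vW; apply: nW; exists i.
  rewrite inE lti /= => /forallPn[j]; rewrite negb_imply -ltnNge => /andP[nji lt].
  by rewrite (bigD1 j) //= muln1; apply: leq_trans (ltnW lt) (leq_addr _ _).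
rewrite exchange_big /= -[p in leqRHS]card_ord -mulnA -sum_nat_const.
by apply: leq_sum => i _; apply: sum_missing.
Qed.

(** Otherwise [W i] contains a complete bipartite graph with sides of size [t]. Its vertices
    together miss at most [2 * t * y] vertices of any other [C j], half of [M], so [p + 1] parts
    arise. *)
Lemma few_inner_dense i k m :
  t * #|G| + m * (t * 2 ^ m) < m * k ->
  #|[set v in W i | k <= #|W i :&: nbhd v|]| < m.
Proof.
move=> hm; rewrite ltnNge; apply/negP => le_m.
set Y := [set v in _ | _] in le_m; have cX := card_some_subset le_m.
have sX := some_subset_sub m Y.
have [||S [S' [sS sS' cS cS' adj]]] := @complete_pair_of_dense t k (W i) (some_subset m Y).
- by move=> x /(subsetP sX); rewrite inE => /andP[].
- by rewrite cX; apply: leq_ltn_trans hm; rewrite leq_add2r leq_mul2l max_card orbT.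
have sSW : S \subset W i.
  apply: subset_trans sS (subset_trans sX _).
  by apply/subsetP => v; rewrite inE => /andP[].
have big j : j != i -> t <= #|C j :&: common (S :|: S')|.
  move=> nji; have : #|C j| <= #|C j :&: common (S :|: S')| + #|S :|: S'| * y.
    apply: card_common => v; rewrite inE => /orP[/(subsetP sSW)|/(subsetP sS')].
      by rewrite inE => /andP[_ /forallP/(_ j)]; rewrite nji.
    by rewrite inE => /andP[_ /forallP/(_ j)]; rewrite nji.
  rewrite cC ME.
  have : #|S :|: S'| * y <= (t + t) * y 
    by rewrite leq_mul2r; apply/orP; right; rewrite -{1}cS -cS'; apply: leq_card_setU.
  by have : t * 1 <= t * y; [rewrite leq_mul2l; lia | lia].
apply: free; exists S, (fun j => if j == i then S' else C j :&: common (S :|: S')); split.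
- by rewrite cS.
- by move=> j; case: eqVneq => [_|/big //]; rewrite cS'.
- move=> j; case: eqVneq => _ x z xS; first exact: adj.
  by case/setIP=> _ /commonP; apply; rewrite inE xS.
- move=> j l njl x z; case: (eqVneq j i) => [Ej|nj]; case: (eqVneq l i) => [El|nl].
  + by rewrite Ej El eqxx in njl.
  + by move=> xS /setIP[_ /commonP]; apply; rewrite inE xS orbT.
  + by move=> /setIP[_ /commonP h] zS; rewrite edgeC; apply: h; rewrite inE zS orbT.
  + by move=> /setIP[xC _] /setIP[zC _]; apply: (adjC njl).
Qed.

(** [U i] is [W i] without its few vertices of large degree inside [W i]. As no [W j] is much larger
    than [c], and [E] and [At] are small, no [W i] is much smaller than [c] either. *)
Lemma near_partition_of_multipartite q m : 
  0 < q -> m = 4 * t * q -> y = 3 * t * q -> p * c <= #|G| + p ->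
  p + 3 * q * (1 + 4 * t) * (p + t * 2 ^ (p * M)) + 3 * q * m <= #|G| ->
  2 * q + 8 * q * (t * 2 ^ m) <= #|G| ->
  exists U : 'I_p -> {set G}, [/\ forall i j, i != j -> [disjoint U i & U j],
    forall i, q * (c - #|U i|) <= #|G| &
    forall i, {in U i, forall u, q * #|U i :&: nbhd u| <= #|G|}].
Proof.
move=> q0 mE yE hpc big1 big2.
pose k := #|G| %/ q; pose Y i := [set v in W i | k <= #|W i :&: nbhd v|].
have hm : t * #|G| + m * (t * 2 ^ m) < m * k.
  have : #|G| < q * k.+1 by rewrite mulnC ltn_ceil.
  rewrite mE in big2 *; move: (t * 2 ^ _) big2 => x big2 /(leq_mul (leqnn t)) h1.
  by have h2 := leq_mul (leqnn t) big2; lia.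
have leY i : #|Y i| < m by apply: few_inner_dense.
have sYW i : Y i \subset W i by apply/subsetP => v; rewrite inE => /andP[].
have cW i : 3 * q * (#|W i| - c) <= c.
  have [le|lt] := leqP #|W i| c; first by rewrite (eqP le) muln0.
  have Mt : M - t = t * (4 * y - 1) by rewrite ME mulnBr; lia.
  have := card_typical i; rewrite Mt ME -(subnK (ltnW lt)).
  move: (#|W i| - c) => d h.
  have {}h : (d + c) * (4 * y - 1) <= 4 * y * c.
    by rewrite -(leq_pmul2l t_gt0) mulnCA (leq_trans h) // [4 * t]mulnC -!mulnA.
  have {}h : d * (4 * y - 1) <= c.
    have -> : d * (4 * y - 1) = (d + c) * (4 * y - 1) - c * (4 * y - 1) by rewrite -mulnBl addnK.
    by rewrite mulnBr; lia.
  apply: leq_trans h; rewrite addnK mulnC leq_mul2l yE; apply/orP; right.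
  by have : q <= t * q; [rewrite leq_pmull | lia].
have cA : 3 * q * #|At| <= #|G| + 3 * q * (4 * t) * (#|E| + p).
  have h1 : p * M * c <= M * (#|G| + p).
    by rewrite mulnAC [_ * M]mulnC leq_mul2l hpc orbT.
  have h2 : #|G| * (M - t) <= (#|G| - #|E|) * (M - t) + #|E| * M.
    apply: (@leq_trans ((#|G| - #|E|) * (M - t) + #|E| * (M - t))).
      by rewrite -mulnDl subnK ?max_card.
    by rewrite leq_add2l leq_mul2l leq_subr orbT.
  have h3 : #|G| * M <= #|G| * (M - t) + #|G| * t.
    by rewrite -mulnDr leq_mul2l addnC -leq_subLR leqnn orbT.
  have h4 : y * #|At| <= #|G| * t + M * (#|E| + p) by have := card_atypical; lia.
  by rewrite -(leq_pmul2l t_gt0); move: h4; rewrite ME yE; lia.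
have leE := few_dominating.
exists (fun i => W i :\: Y i); split.
- move=> i j /typical_disjoint d; apply: disjointWl (subsetDl _ _) _.
  exact: disjointWr (subsetDl _ _) d.
- move=> i; have cU : #|W i :\: Y i| = #|W i| - #|Y i|.
    by rewrite cardsD (setIidPr (sYW i)).
  have tot : #|G| <= #|E| + #|At| + #|W i| + \sum_(j | j != i) #|W j|.
    have := cardsC (E :|: \bigcup_i W i); rewrite -/At.
    have := leq_trans (leq_card_setU E (\bigcup_i W i)) 
      (leq_add (leqnn _) (card_bigcup_le xpredT W)).
    rewrite [X in _ <= _ + X](bigD1 i) //=.
    by move: #|_ :|: _| #|\bigcup_i W i| #|At| (\sum_(j | _) _) => a b d S; lia.
  have hs : 3 * q * \sum_(j | j != i) (#|W j| - c) <= p * c.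
    rewrite big_distrr /=; apply: (@leq_trans (\sum_(j : 'I_p | j != i) c)).
      by apply: leq_sum => j _; apply: cW.
    by rewrite sum_nat_const leq_mul2r -[X in _ <= X]card_ord max_card orbT.
  have hs2 : \sum_(j | j != i) #|W j| <= (p - 1) * c + \sum_(j | j != i) (#|W j| - c).
    have -> : (p - 1) * c = \sum_(j | j != i) c.
      by rewrite sum_nat_const cardC1 card_ord subn1.
    by rewrite -big_split /=; apply: leq_sum => j _; lia.
  have p0 : 0 < p := leq_ltn_trans (leq0n i) (ltn_ord i).
  (* Three errors of about [#|G| / (3 * q)] are allowed: the excesses of the other classes over [c],
     the set [At], and the constants collected in [big1]. *)
  have h3 : c - #|W i| <= p + #|E| + #|At| + \sum_(j | j != i) (#|W j| - c).
    have : p * c = c + (p - 1) * c by rewrite -mulSn subn1 prednK.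
    by move: tot hs2 hpc; move: (\sum_(j | _) _) (\sum_(j | _) _) ((p - 1) * c) => R S pc; lia.
  rewrite cU; set S := \sum_(j | _) _ in h3 hs.
  have k1 : c - (#|W i| - #|Y i|) <= p + #|E| + #|At| + S + m by have := leY i; lia.
  have k2 : 3 * q * (c - (#|W i| - #|Y i|)) <= 3 * q * (p + #|E| + #|At| + S + m).
    by rewrite leq_mul2l k1 orbT.
  have k3 : 3 * q * (1 + 4 * t) * (p + #|E|) <= 3 * q * (1 + 4 * t) * (p + t * 2 ^ (p * M)).
    by rewrite leq_mul2l leq_add2l leE orbT.
  rewrite -(leq_pmul2l (isT : 0 < 3)) mulnA; apply: leq_trans k2 _.
  move: cA hs k3 big1 hpc; rewrite !mulnDr !mulnDl; lia.
- move=> i u /setDP[uW]; rewrite inE uW /= -ltnNge => lt.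
  apply: (@leq_trans (q * k)); last by rewrite mulnC leq_trunc_div.
  rewrite leq_mul2l; apply/orP; right; apply: leq_trans (ltnW lt).
  exact/subset_leq_card/setSI/subsetDl.
Qed.

End Stability.

Lemma near_partition p t q : 0 < p -> 0 < t -> 0 < q -> exists n0, forall (G : sgraph) c,
  n0 <= #|G| -> (forall v : G, #|~: nbhd v| <= c) -> p * c <= #|G| + p ->
  ~ has_complete_multipartite G p t ->
  exists U : 'I_p -> {set G}, [/\ forall i j, i != j -> [disjoint U i & U j],
    forall i, q * (c - #|U i|) <= #|G| &
    forall i, {in U i, forall u, q * #|U i :&: nbhd u| <= #|G|}].
Proof.
move=> p0 t0 q0; pose y := 3 * t * q; pose M := 4 * t * y; pose m := 4 * t * q.
have M0 : 0 < M by rewrite /M /y !muln_gt0 t0 q0.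
have [n1 Hn1] := @multipartite_of_min_degree p p M M0 (leqnn p).
exists (maxn n1 (maxn (p + 3 * q * (1 + 4 * t) * (p + t * 2 ^ (p * M)) + 3 * q * m)
                      (2 * q + 8 * q * (t * 2 ^ m)))) => G c.
rewrite !geq_max => /and3P[h1 h2 h3] hc hpc free.
have [C [cC adjC]] := Hn1 G c h1 hc hpc.
apply: (@near_partition_of_multipartite G p t y M c (fun i : 'I_p => C i)) h3 => //.
- by rewrite /y mulnAC leq_pmull // muln_gt0.
- by move=> i; apply: cC.
- by move=> i j nij x z xC zC; apply: (adjC i j).
Qed.

(** * Balanced class sizes *)

(* Number of pairs of distinct vertices of the same class of the Turán graph. *)
Definition turan_missing p N := \sum_(j < N) j %/ p.

Lemma turan_missingS p N : turan_missing p N.+1 = turan_missing p N + N %/ p.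
Proof. exact: big_ord_recr. Qed.

Lemma turan_missing_addr p N k :
  turan_missing p N + k * (N %/ p) <= turan_missing p (N + k).
Proof.
elim: k => [|k IH]; first by rewrite !addn0.
have := leq_div2r p (leq_addr k N); rewrite addnS turan_missingS; lia.
Qed.

Lemma turan_missing_addl p N k M : N + k <= M.+1 ->
  turan_missing p (N + k) <= turan_missing p N + k * (M %/ p).
Proof.
elim: k => [|k IH] le; first by rewrite !addn0.
have := @leq_div2r p (N + k) M; rewrite addnS turan_missingS; lia.
Qed.

Lemma sum_update (I : finType) (F G : I -> nat) i :
  (forall j, j != i -> F j = G j) -> \sum_j F j + G i = \sum_j G j + F i.
Proof.
move=> FG; rewrite (bigD1 i) //= [in RHS](bigD1 i) //=.
by rewrite (eq_bigr _ FG); move: (\sum_(j | _) _) => S; lia.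
Qed.

Section Sizes.
Variables (p : nat).
Hypothesis p_gt0 : 0 < p.

(** The left side counts ordered pairs, equal ones included, in a common class of the Turán graph.
    The induction removes a vertex from a largest class, which has at least [N %/ p] other
    members. *)
Lemma sum_squares_ge (m : 'I_p -> nat) N : \sum_i m i = N ->
  N + 2 * turan_missing p N <= \sum_i m i ^ 2.
Proof.
elim: N m => [|N IH] m mN; first by rewrite /turan_missing big_ord0.
pose i0 := Ordinal p_gt0; pose i := [arg max_(j > i0) m j].
have maxi j : m j <= m i by rewrite /i; case: arg_maxnP => // k _; apply.
have le : N.+1 <= p * m i.
  rewrite -mN -[p in p * _]card_ord -sum_nat_const; exact: leq_sum.
pose m' j := if j == i then (m i).-1 else m j.
have nji j : j != i -> m j = m' j by rewrite /m' => /negPf->.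
have nji2 j : j != i -> m j ^ 2 = m' j ^ 2 by move/nji->.
have m'i : m' i = (m i).-1 by rewrite /m' eqxx.
have := sum_update nji; have := sum_update nji2; rewrite mN m'i => E2 E1.
have mi : 0 < m i by rewrite lt0n; apply: contraTneq le => ->; rewrite muln0.
have := IH m' ltac:(lia); rewrite turan_missingS.
have : N %/ p <= (m i).-1 by rewrite -ltnS prednK // ltn_divLR // mulnC.
case: (m i) mi E2 E1 => // a _; rewrite /= !expnS !expn0; lia.
Qed.

(** If two sizes differed by two or more, moving one unit would push the sum of squares below its
    minimum. *)
Lemma balanced_of_sum_squares (m : 'I_p -> nat) N : \sum_i m i = N ->
  \sum_i m i ^ 2 <= N + 2 * turan_missing p N -> forall i j, m i <= (m j).+1.
Proof.
move=> mN le i j; rewrite leqNgt; apply/negP => lt.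
have nij : j != i by apply: contraTneq lt => ->; rewrite -leqNgt leqW.
pose m1 k := if k == i then (m i).-1 else m k.
pose m2 k := if k == j then (m j).+1 else m1 k.
have n1 k : k != i -> m k = m1 k by rewrite /m1 => /negPf->.
have n2 k : k != j -> m1 k = m2 k by rewrite /m2 => /negPf->.
have s1 k : k != i -> m k ^ 2 = m1 k ^ 2 by move/n1->.
have s2 k : k != j -> m1 k ^ 2 = m2 k ^ 2 by move/n2->.
have m1j : m1 j = m j by rewrite n1.
have m2j : m2 j = (m j).+1 by rewrite /m2 eqxx.
have m1i : m1 i = (m i).-1 by rewrite /m1 eqxx.
have := sum_update n1; have := sum_update n2; have := sum_update s1; have := sum_update s2.
rewrite m1j m2j m1i mN => E4 E3 E2 E1.
have := @sum_squares_ge m2 N ltac:(lia).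
move: lt le E4 E3; move: (\sum_j m j ^ 2) (\sum_j m1 j ^ 2) (\sum_j m2 j ^ 2) => S S1 S2.
by case: (m i) => // a; rewrite /= !expnS !expn0; lia.
Qed.

Lemma balanced_range (m : 'I_p -> nat) : (forall i j, m i <= (m j).+1) ->
  forall i, (\sum_j m j) %/ p <= m i <= ((\sum_j m j) %/ p).+1.
Proof.
move=> bal i; apply/andP; split.
  rewrite -ltnS ltn_divLR // -[p in _ * p]card_ord mulnC -sum_nat_const.
  rewrite (bigD1 i) //= [ltnRHS](bigD1 i) //= -addSn; apply: leq_add => //.
  by apply: leq_sum => j _.
rewrite leqNgt; apply/negP => lt.
have : (\sum_j m j) %/ p < (\sum_j m j) %/ p; last by rewrite ltnn.
rewrite leq_divRL // -[p in _ * p]card_ord mulnC -sum_nat_const.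
by apply: leq_sum => j _; rewrite -ltnS; apply: leq_trans lt (bal i j).
Qed.

Lemma balanced_count (m : 'I_p -> nat) : (forall i j, m i <= (m j).+1) ->
  let N := \sum_j m j in
  forall x, count_mem x [seq m i | i <- enum 'I_p] =
    if x == (N %/ p).+1 then N %% p else if x == N %/ p then p - N %% p else 0.
Proof.
move=> bal N; have rng := balanced_range bal; rewrite -/N in rng.
pose c := #|[set i | m i == (N %/ p).+1]|.
have cE : N = p * (N %/ p) + c.
  rewrite {1}/N -[p in p * _]card_ord -sum_nat_const.
  have -> : c = \sum_(i < p) (m i == (N %/ p).+1).
    by rewrite /c -sum1_card big_mkcond; apply: eq_bigr => i _; rewrite inE; case: eqP.
  rewrite -big_split; apply: eq_bigr => i _ /=; have := rng i.
  by case: eqP => /= [->|]; lia.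
have modE : N %% p = c by have := divn_eq N p; lia.
have cnt x : count_mem x [seq m i | i <- enum 'I_p] = #|[set i | m i == x]|.
  rewrite count_map enumT cardsE cardE /enum_mem size_filter.
  by apply: eq_count => i /=.
move=> x; rewrite cnt; case: eqVneq => [->|n1]; first by rewrite modE.
case: eqVneq => [->|n2].
  have := cardsC [set i | m i == (N %/ p).+1]; rewrite card_ord -/c modE.
  have -> : ~: [set i | m i == (N %/ p).+1] = [set i | m i == N %/ p].
    by apply/setP => i; rewrite !inE; have := rng i; lia.
  lia.
apply/eqP; rewrite cards_eq0; apply/eqP/setP => i; rewrite !inE.
by apply/eqP => E; have := rng i; lia.
Qed.

(** The sum determines balanced sizes up to order, by [balanced_count]. *)
Lemma balanced_perm (m m' : 'I_p -> nat) :
  (forall i j, m i <= (m j).+1) -> (forall i j, m' i <= (m' j).+1) ->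
  \sum_i m i = \sum_i m' i -> exists s : {perm 'I_p}, forall i, m i = m' (s i).
Proof.
move=> bal bal' E.
have /tuple_permP[s Es] : perm_eq [tuple m i | i < p] [tuple m' i | i < p].
  apply/allP => x _ /=; apply/eqP.
  by rewrite (balanced_count bal) (balanced_count bal') E.
exists s => i; have := congr1 (fun u => tnth u i) (val_inj Es).
by rewrite !tnth_mktuple.
Qed.

End Sizes.

(** * Structure of dense graphs without the blow-up *)

(** Greedy matching: if it stops before [k] edges, the ends of the edges found form a cover. *)
Lemma matching_or_cover (G : sgraph) (S : {set G}) k :
  (exists m : nat -> G * G,
     (forall i, i < k -> [/\ (m i).1 \in S, (m i).2 \in S & (m i).1 -- (m i).2]) /\
     (forall i j, i < k -> j < k -> i != j ->
        [disjoint [set (m i).1; (m i).2] & [set (m j).1; (m j).2]])) \/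
  (exists C : {set G}, #|C| <= 2 * k /\ {in S :\: C &, forall x y, ~~ (x -- y)}).
Proof.
elim: k S => [|k IH] S.
  (* Even an empty matching is a total function into [G * G], so a graph without vertices goes to
     the second case. *)
  have [/existsP[x0 _]|none] := boolP [exists x : G, true].
    by left; exists (fun=> (x0, x0)).
  by right; exists set0; rewrite cards0; split=> // x; move/existsPn: none => /(_ x).
have [iS|] := boolP (independent S).
  right; exists set0; rewrite cards0; split=> // x y; rewrite !setD0 => xS yS.
  by move/forall_inP: iS => /(_ x xS)/forall_inP/(_ y yS).
case/forall_inPn => x xS /forall_inPn[y yS]; rewrite negbK => xy.
have [[m [m1 m2]]|[C [cC iC]]] := IH (S :\: [set x; y]).
  left; exists (fun i => if i < k then m i else (x, y)).
  have dis i : i < k -> [disjoint [set (m i).1; (m i).2] & [set x; y]].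
    move=> /m1[h1 h2 _]; rewrite disjoints_subset subUset !sub1set !in_setC.
    by move: h1 h2; rewrite !inE => /andP[-> _] /andP[-> _].
  split=> [i _|i j].
    by case: ifP => [/m1[]|_ //]; rewrite !inE => /andP[_ ->] /andP[_ ->].
  rewrite !ltnS => ik jk nij; case: ltnP => hi; case: ltnP => hj.
  - exact: m2.
  - exact: dis.
  - by rewrite disjoint_sym; apply: dis.
  - by move: nij; rewrite (_ : i = j) ?eqxx //; lia.
right; exists (C :|: [set x; y]); split; last first.
  by rewrite setUC -setDDl.
by apply: leq_trans (leq_card_setU _ _) _; rewrite cards2; case: (x != y); lia.
Qed.

(** Every edge inside [S] has an end in [C], each vertex of [C] in [S] lies on at most [d] of them,
    and the sum counts each edge twice. *)
Lemma sum_degree_cover (G : sgraph) (S C : {set G}) d :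
  {in S, forall x, #|S :&: nbhd x| <= d} -> {in S :\: C &, forall x y, ~~ (x -- y)} ->
  \sum_(x in S) #|S :&: nbhd x| <= 2 * #|C| * d.
Proof.
move=> hd hC; rewrite (bigID (mem C)) /= -mulnA mul2n -addnn.
have le1 : \sum_(x in S | x \in C) #|S :&: nbhd x| <= #|C| * d.
  apply: (@leq_trans (\sum_(x in S | x \in C) d)); first by apply: leq_sum => x /andP[/hd].
  rewrite sum_nat_const leq_mul2r; apply/orP; right.
  by apply: subset_leq_card; apply/subsetP => x /andP[].
apply: leq_add => //; apply: leq_trans _ le1.
have -> : \sum_(x in S | x \in C) #|S :&: nbhd x| = \sum_(x in S :&: C) #|S :&: nbhd x|.
  by apply: eq_bigl => x; rewrite inE.
rewrite double_count [leqRHS](bigID (mem C)) /=.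
apply: leq_trans (leq_addl _ _); apply: leq_sum => x /andP[xS xC].
apply/subset_leq_card/subsetP => y; rewrite !inE => /andP[yS xy].
rewrite yS xy andbT /=; case yC: (y \in C) => //.
by have := hC x y; rewrite !inE xS xC yS yC xy => /(_ isT isT).
Qed.

Lemma sum_leq_pointwise (I : finType) (f g : I -> nat) :
  (forall x, f x <= g x) -> \sum_x g x <= \sum_x f x -> forall x, g x <= f x.
Proof.
move=> fg; move=> le x; move: le; rewrite (bigD1 x) //= [leqRHS](bigD1 x) //=.
have : \sum_(i | i != x) f i <= \sum_(i | i != x) g i by apply: leq_sum.
by move: (\sum_(i | _) f i) (\sum_(i | _) g i); clear; lia.
Qed.

Section Structure.
Variables (T : sgraph) (A B : {set T}) (p : nat) (G : sgraph) (c z : nat).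
Variable U : 'I_p -> {set G}.
Hypotheses (hAB : bipartition A B) (A_gt0 : 0 < #|A|) (p_ge3 : 3 <= p).
Hypothesis free : ~ contains G (blowup T p.+1).
Hypothesis hc : forall v : G, #|~: nbhd v| <= c.
Hypothesis Udis : forall i j, i != j -> [disjoint U i & U j].
Hypothesis Ularge : forall i, c <= #|U i| + z.
Hypothesis Uinner : forall i, {in U i, forall u, #|U i :&: nbhd u| <= z}.
Hypothesis hn : #|G| <= p * c + #|A|.
(* The scales are ordered as [z << b << w << c]. *)
Let b := (2 * p + 4) * z.
Let w := 4 * p * #|T| ^ 2 * b + 2 * b.
Hypothesis z_large : #|T| + 2 * #|T| ^ 2 * p + #|T| * 2 ^ (2 * #|T|) * p <= z.
Hypothesis c_large : (2 * #|T| ^ 2 + #|T| + 20) * w <= c.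

Let V i := [set v | #|U i :&: nbhd v| < b].
Let D := ~: \bigcup_i V i.

(** * Sorting the vertices by their adjacency to the sets [U i] *)

Let p_gt0 : 0 < p.
Proof. exact: leq_trans p_ge3. Qed.

Let leAT : #|A| <= #|T|.
Proof. exact: max_card. Qed.

Let T_gt0 : 0 < #|T|.
Proof. exact: leq_trans leAT. Qed.

Let z_gt0 : 0 < z.
Proof. by apply: leq_trans z_large; rewrite -addnA ltn_addr. Qed.

Let leTz : #|T| <= z.
Proof. by apply: leq_trans z_large; rewrite -addnA leq_addr. Qed.

Let leb : 10 * z <= b.
Proof. by rewrite leq_mul2r; apply/orP; right; lia. Qed.

Let lew : 2 * b <= w.
Proof. exact: leq_addl. Qed.

Let lec : 20 * w <= c.
Proof. by apply: leq_trans c_large; rewrite leq_mul2r leq_addl orbT. Qed.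

Let room_lt : room T p (2 * z) + 2 * z < b.
Proof.
have : #|T| + 2 * #|T| ^ 2 * p <= z by apply: leq_trans z_large; rewrite leq_addr.
by rewrite /room /b; lia.
Qed.

Let room_ltw : room T p (2 * z) < w + w.
Proof. by move: room_lt lew; move: (room _ _ _) => r; clear; lia. Qed.

Let lezw : 2 * z <= w.
Proof. by move: leb lew; clear; lia. Qed.

Let leTw : #|T| <= w.
Proof. by move: leTz lezw; clear; lia. Qed.

(** A vertex with few neighbours in [U i] spends nearly all of its at most [c] non-neighbours there,
    since [U i] has nearly [c] vertices. *)
Lemma outside_miss i v k : #|U i :&: nbhd v| <= k -> #|~: nbhd v :\: U i| <= z + k.
Proof.
move=> lek; have := cardsID (U i) (~: nbhd v); have := cardsID (nbhd v) (U i).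
have -> : ~: nbhd v :&: U i = U i :\: nbhd v by rewrite setDE setIC.
by have := hc v; have := Ularge i; lia.
Qed.

Lemma outside_missU i j v k : i != j -> #|U i :&: nbhd v| <= k -> #|U j :\: nbhd v| <= z + k.
Proof.
move=> nij /outside_miss; apply: leq_trans; apply/subset_leq_card/subsetP => u.
rewrite !inE => /andP[-> uj]; rewrite andbT.
by apply/negP => ui; have := disjointFr (Udis nij) ui; rewrite uj.
Qed.

Lemma U_miss i j u : i != j -> u \in U i -> #|U j :\: nbhd u| <= 2 * z.
Proof. by move=> nij /Uinner/(outside_missU nij); rewrite mul2n -addnn. Qed.

Lemma V_miss i j v : i != j -> v \in V i -> #|U j :\: nbhd v| <= w.
Proof.
move=> nij; rewrite inE => /ltnW/(outside_missU nij) h; apply: leq_trans h _; lia.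
Qed.

Lemma U_sub_V i : U i \subset V i.
Proof. by apply/subsetP => u /Uinner h; rewrite inE; lia. Qed.

(** A vertex of both sets would have fewer than [b] neighbours in [U j] and miss at most [w] of its
    vertices, but [U j] is larger than [b + w]. *)
Lemma V_dis i j : i != j -> [disjoint V i & V j].
Proof.
move=> nij; rewrite -setI_eq0 -subset0; apply/subsetP => v /setIP[/(V_miss nij)].
rewrite inE; have := cardsID (nbhd v) (U j); have := Ularge j; lia.
Qed.

Lemma V_notin i j v : i != j -> v \in V i -> v \notin V j.
Proof. by move=> nij vi; rewrite (disjointFr (V_dis nij) vi). Qed.

Lemma in_D v : (v \in D) = [forall i, b <= #|U i :&: nbhd v|].
Proof.
rewrite inE; apply/idP/forallP => [/bigcupP h i|h].
  by rewrite leqNgt; apply/negP => lt; apply: h; exists i; rewrite ?inE.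
by apply/bigcupP => -[i _]; rewrite inE ltnNge h.
Qed.

Lemma notin_D v : v \notin D -> exists i, v \in V i.
Proof. by rewrite inE negbK => /bigcupP[i _ vi]; exists i. Qed.

Lemma V_notin_D i v : v \in V i -> v \notin D.
Proof. by move=> vi; rewrite inE negbK; apply/bigcupP; exists i. Qed.

Lemma card_bigU : p * c <= #|\bigcup_i U i| + p * z.
Proof.
have -> : #|\bigcup_i U i| = \sum_i #|U i|.
  rewrite -sum1_card partition_disjoint_bigcup //; apply: eq_bigr => i _.
  by rewrite sum1_card.
rewrite -[p in p * c]card_ord -[p in p * z]card_ord -!sum_nat_const -big_split /=.
exact: leq_sum.
Qed.

(** Fewer than [b] of these neighbours lie in [U i]. The others lie in no [U j], and by the sizes of
    the [U j] only [p * z + #|A|] vertices can do so. *)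
Lemma V_inner i v : v \in V i -> #|V i :&: nbhd v| <= 2 * b.
Proof.
rewrite inE => lt.
apply: (@leq_trans (#|U i :&: nbhd v| + #|~: \bigcup_j U j|)).
  apply: leq_trans (leq_card_setU _ _); apply/subset_leq_card/subsetP => u.
  move=> /setIP[ui uv]; rewrite in_setU in_setI in_setC uv andbT.
  case uU: (u \in \bigcup_j U j); last by rewrite orbT.
  case/bigcupP: uU => j _ uj; have [<-|nji] := eqVneq j i; first by rewrite uj.
  by have := V_notin nji (subsetP (U_sub_V j) _ uj); rewrite ui.
have := cardsC (\bigcup_j U j); have := card_bigU; have : p * z + #|A| <= b by rewrite /b; lia.
lia.
Qed.

(** The bound on [#|Z|] has room for the ends of [#|T| ^ 2] matching edges with an image of [A], or
    for [D] and a few more vertices. *)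
Lemma big_common l (Z : {set G}) :
  {in Z, forall x, #|U l :\: nbhd x| <= w} -> #|Z| <= 2 * #|T| ^ 2 + #|T| + 10 ->
  w + w <= #|U l :&: common Z|.
Proof.
move=> hZ cZ; have := card_common hZ; have := Ularge l.
have : #|Z| * w <= (2 * #|T| ^ 2 + #|T| + 10) * w by rewrite leq_mul2r cZ orbT.
move: c_large; rewrite !mulnDl; lia.
Qed.

(** * Excluding large matchings inside a class *)

Lemma third_class (i j : 'I_p) : exists k, k != i /\ k != j.
Proof.
have /card_gt0P[k] : 0 < #|~: [set i; j]|.
  have := cardsC [set i; j]; rewrite card_ord cards2; have := leq_b1 (i != j); lia.
by rewrite !inE negb_or => /andP[]; exists k.
Qed.

Lemma card_others (S : {set 'I_p}) : #|S| + #|~: S| = p.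
Proof. by rewrite cardsC card_ord. Qed.

Lemma card_others3 (i j k : 'I_p) : i != j -> i != k -> j != k -> #|~: [set i; j; k]| = p - 3.
Proof.
move=> ij ik jk; have := card_others ([set i; j] :|: [set k]).
rewrite [[set i; j] :|: _]setUC cardsU1 cards2 !inE negb_or [k == i]eq_sym [k == j]eq_sym.
by rewrite ij ik jk; move: #|~: _| => X; clear; lia.
Qed.

Lemma card_others2 (i j : 'I_p) : i != j -> #|~: [set i; j]| = p - 2.
Proof.
by move=> ij; have := card_others [set i; j]; rewrite cards2 ij; move: #|~: _| => X; clear; lia.
Qed.

(** [A] goes to [U j] and [B] to [U k]. Each edge of [T] gets its own matching edge as two of its
    [p - 1] new vertices, and the other [p - 3] come from the remaining classes. *)
Lemma no_inner_matching i (m : nat -> G * G) :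
  (forall x, x < #|T| ^ 2 -> [/\ (m x).1 \in V i, (m x).2 \in V i & (m x).1 -- (m x).2]) ->
  (forall x y, x < #|T| ^ 2 -> y < #|T| ^ 2 -> x != y ->
        [disjoint [set (m x).1; (m x).2] & [set (m y).1; (m y).2]]) -> False.
Proof.
move=> mV mdis; apply: free.
have [j [nji _]] := third_class i i; have [k [nki nkj]] := third_class i j.
pose e x := [set (m x).1; (m x).2].
pose M := \bigcup_(x < #|T| ^ 2) e x.
have eV x : x < #|T| ^ 2 -> e x \subset V i.
  by move=> /mV[h1 h2 _]; rewrite subUset !sub1set h1 h2.
have eM x : x < #|T| ^ 2 -> e x \subset M.
  by move=> lt; apply: (bigcup_sup (Ordinal lt)).
have MV : M \subset V i by apply/bigcupsP => x _; apply: eV.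
have cM : #|M| <= 2 * #|T| ^ 2.
  apply: leq_trans (card_bigcup_le _ _) _.
  apply: (@leq_trans (\sum_(x < #|T| ^ 2) 2)); last by rewrite sum_nat_const card_ord mulnC.
  by apply: leq_sum => x _; rewrite cards2; case: (_ != _).
have Mmiss l x : l != i -> x \in M -> #|U l :\: nbhd x| <= w.
  by move=> nli /(subsetP MV); apply: V_miss; rewrite eq_sym.
have big1 : w + w <= #|U j :&: common M|.
  by apply: big_common => [x|]; [apply: Mmiss | move: cM; clear; lia].
have leTJ : #|T| <= #|U j :&: common M| by move: leTw big1; clear; lia.
have /card_gt0P[y0 _] := leq_trans T_gt0 leTJ.
have [|g [ginj gin]] := @injection_into T G y0 A (U j :&: common M) _; first exact: leq_trans leTJ.
have gU a : a \in A -> g a \in U j by move=> /gin/setIP[].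
have gmiss l a : l != j -> a \in A -> #|U l :\: nbhd (g a)| <= w.
  by move=> nlj /gU ga; apply: (@leq_trans (2 * z)); [apply: U_miss ga; rewrite eq_sym | ].
have gA : #|M :|: g @: A| <= 2 * #|T| ^ 2 + #|T|.
  apply: leq_trans (leq_card_setU _ _) _; apply: leq_add => //.
  exact: leq_trans (leq_imset_card _ _) leAT.
pose cand := U k :&: common (M :|: g @: A).
have big2 : w + w <= #|cand|.
  apply: big_common; last by move: gA; clear; lia.
  move=> x /setUP[xM|/imsetP[a aA ->]]; [exact: Mmiss | exact: gmiss].
(* There are [#|T| ^ 2] ordered pairs, so the rank of a pair can index the matching edge reserved
   for it. *)
pose rk (a b' : T) : nat := enum_rank (a, b').
have rk_lt a b' : rk a b' < #|T| ^ 2.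
  by rewrite /rk -mulnn -card_prod ltn_ord.
have J0 : #|~: [set i; j; k]| = p - 3 by rewrite card_others3 // eq_sym.
apply: (@blowup_from_A T G A B p hAB p_gt0 g (fun=> cand) _ U (2 * z)
  (fun a b' => e (rk a b')) (fun _ _ => ~: [set i; j; k]) ginj).
- by move=> *; move: leTw big2; clear; lia.
- by move=> i' j' u; apply: U_miss.
- move=> a b' aA bB ab; have lt := rk_lt a b'; have [m1 m2 m3] := mV _ lt.
  have ge y : y \in e (rk a b') -> g a -- y.
    move=> ye; have /setIP[_ /commonP h] := gin a aA.
    by rewrite edgeC; apply: h; apply: (subsetP (eM _ lt)).
  split.
  + by rewrite J0 cards2 (edge_neq m3); move: p_ge3; clear; lia.
  + apply: cliqueU; first exact: clique1; last by move=> x y /set1P-> /ge.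
    by move=> x y /set2P[]-> /set2P[]->; rewrite ?eqxx // edgeC.
  + move=> x xA; apply/negP => /(subsetP (eV _ lt)); apply/negP.
    exact: V_notin nji (subsetP (U_sub_V j) _ (gU x xA)).
  + move=> _ _; rewrite disjoints_subset; apply/subsetP => x /(subsetP (eV _ lt)) xV.
    rewrite !inE negb_and; apply/orP; left; apply/negP => /(subsetP (U_sub_V k)).
    by apply/negP; apply: V_notin xV; rewrite eq_sym.
  + move=> y /setIP[yU /commonP yc]; split.
      apply/commonP => x /setU1P[->|xe]; apply: yc; rewrite inE ?imset_f ?orbT //.
      by rewrite (subsetP (eM _ lt)).
    move=> l; rewrite !inE !negb_or -andbA => /and3P[nli nlj nlk].
    apply: (leq_trans room_ltw).
    apply: big_common => [x /setU1P[->|/setU1P[->|xe]]|].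
    * exact: gmiss.
    * by apply: (@leq_trans (2 * z)); [apply: U_miss yU; rewrite eq_sym | ].
    * by apply: Mmiss; rewrite ?(subsetP (eM _ lt)).
    * apply: (@leq_trans 4); last by clear; lia.
      by rewrite !cardsU1 cards1; do 3!case: (~~ _).
- move=> a b' a' b'' _ _ _ _ _ _ nab; apply: mdis => //; apply: contraNneq nab => E.
  by apply/eqP/enum_rank_inj/val_inj.
Qed.

(** With a cover of [2 * #|T| ^ 2] vertices and inner degrees at most [2 * b], a class contributes
    at most [8 * #|T| ^ 2 * b]; [w] is chosen so that [2 * w] absorbs [p] such terms. *)
Lemma inner_sum_le : \sum_i \sum_(x in V i) #|V i :&: nbhd x| <= 2 * w.
Proof.
apply: (@leq_trans (\sum_(i < p) 8 * #|T| ^ 2 * b)); last first.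
  by rewrite sum_nat_const card_ord /w; lia.
apply: leq_sum => i _; have [[m [m1 m2]]|[C [cC iC]]] := matching_or_cover (V i) (#|T| ^ 2).
  by case: (@no_inner_matching i m).
apply: leq_trans (@sum_degree_cover G (V i) C (2 * b) _ iC) _; first exact: V_inner.
rewrite mulnACA; apply: (@leq_trans (4 * (2 * #|T| ^ 2 * b))); last by lia.
by rewrite !leq_mul.
Qed.

(** Otherwise enough vertices of [U i] share a trace on [D'] with at least [#|A|] elements: [A] goes
    to this trace and [B] to those vertices. *)
Lemma common_few (D' : {set G}) i : D' \subset D ->
  #|[set u in U i | #|A| <= #|D' :&: nbhd u|]| <= #|T| * 2 ^ #|D'|.
Proof.
move=> sD; rewrite leqNgt; apply/negP => /trace_pigeonhole[S sSD ltS].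
set Y := [set v in _ | _] in ltS.
have trace y : y \in Y -> [/\ y \in U i, #|A| <= #|D' :&: nbhd y| & S = D' :&: nbhd y].
  by rewrite !inE -andbA => /and3P[? ? /eqP<-]; rewrite [nbhd y :&: _]setIC.
have /card_gt0P[y0 /trace[_ le0 S0]] : 0 < #|Y| by apply: leq_trans ltS.
apply: free; apply: (@blowup_from_star T G A B p hAB p_gt0 _ U (2 * z) i S Y).
- by rewrite card_ord.
- by move=> i' j' u; apply: U_miss.
- by rewrite S0.
- exact: ltnW.
- exact: T_gt0.
move=> d y dS yY; have [yU _ Sy] := trace y yY; split.
  by move: dS; rewrite Sy inE in_nbhd edgeC => /andP[].
move=> j nji; have := subsetP sD _ (subsetP sSD _ dS); rewrite in_D => /forallP/(_ j) led.
have := @U_miss i j y; rewrite eq_sym nji => /(_ isT yU) ley.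
rewrite setIA -(leq_add2r #|U j :\: nbhd y|).
apply: (@leq_trans b); last first.
  apply: leq_trans led _; rewrite -(cardsID (nbhd y)) leq_add2l.
  exact/subset_leq_card/setSD/subsetIl.
by move: room_lt ley; move: (room _ _ _) => r; clear; lia.
Qed.

Let Uu := \bigcup_i U i.

(** By [common_few], all but at most [z] vertices of the [U i] have fewer than [#|A|] neighbours in
    [D'] and miss the rest of it. The upper bound on [#|D'|] limits the number of traces, which
    keeps the exceptions within [z]. *)
Lemma miss_lower (D' : {set G}) : D' \subset D -> #|A| <= #|D'| <= 2 * #|A| ->
  (#|D'|.+1 - #|A|) * (#|Uu| - z) <= \sum_(d in D') #|Uu :\: nbhd d|.
Proof.
move=> sD /andP[leA leD].
pose P i := [set u in U i | #|A| <= #|D' :&: nbhd u|].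
have cP : #|\bigcup_i P i| <= z.
  apply: leq_trans (card_bigcup_le _ _) _.
  apply: (@leq_trans (\sum_(i < p) #|T| * 2 ^ (2 * #|T|))).
    apply: leq_sum => i _; apply: leq_trans (common_few _ sD) _.
    rewrite leq_mul2l leq_exp2l //; apply/orP; right; apply: leq_trans leD _.
    by rewrite leq_mul2l.
  rewrite sum_nat_const card_ord mulnC; apply: leq_trans z_large; exact: leq_addl.
apply: (@leq_trans (\sum_(u in Uu :\: \bigcup_i P i) #|D' :\: nbhd u|)).
  apply: (@leq_trans (\sum_(u in Uu :\: \bigcup_i P i) (#|D'|.+1 - #|A|))).
    rewrite sum_nat_const mulnC leq_mul2r cardsD; apply/orP; right.
    by apply: leq_sub2l; apply: leq_trans cP; apply/subset_leq_card/subsetIr.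
  apply: leq_sum => u /setDP[/bigcupP[i _ ui] nP].
  have lt : #|D' :&: nbhd u| < #|A|.
    by rewrite ltnNge; apply: contra nP => le; apply/bigcupP; exists i; rewrite ?inE ?ui.
  by move: lt (cardsID (nbhd u) D'); move: #|D' :&: _| #|D' :\: _| => x y; clear; lia.
rewrite [leqRHS]double_countN [leqRHS](bigID (fun u => u \in \bigcup_i P i)) /=.
apply: leq_trans (leq_addl _ _); apply: eq_leq; apply: eq_bigl => u.
by rewrite in_setD andbC.
Qed.

Lemma card_Uu : 3 * c <= #|Uu| + 3 * z.
Proof.
have [le|lt] := leqP c z; first by apply: leq_trans (leq_addl _ _); rewrite leq_mul2l.
apply: (@leq_trans (p * (c - z) + 3 * z)).
  by rewrite -{1}(subnK (ltnW lt)) mulnDr leq_add2r leq_mul2r p_ge3 orbT.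
by rewrite leq_add2r mulnBr leq_subLR addnC card_bigU.
Qed.

(** For [2 * #|A|] vertices of [D], [miss_lower] would give at least [(#|A| + 1) * (2 * c)]
    non-adjacent pairs, as the [U i] cover almost [3 * c] vertices; but each vertex misses at most
    [c] others. *)
Lemma card_D_lt : #|D| < 2 * #|A|.
Proof.
rewrite ltnNge; apply/negP => leD; have cD := card_some_subset leD.
have H := miss_lower (some_subset_sub (2 * #|A|) D).
rewrite cD leqnn andbT in H; have {}H := H (leq_pmull #|A| (isT : 0 < 2)).
have : \sum_(d in some_subset (2 * #|A|) D) #|Uu :\: nbhd d| <= 2 * #|A| * c.
  rewrite -[X in X * c]cD -sum_nat_const; apply: leq_sum => d _; apply: leq_trans (hc d).
  by apply/subset_leq_card; rewrite setDE subsetIr.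
move/(leq_trans H); apply/negP; rewrite -ltnNge.
have h1 : 2 * c <= #|Uu| - z by move: card_Uu leb lew lec; move: #|Uu|; clear; lia.
rewrite (_ : (2 * #|A|).+1 - #|A| = #|A|.+1); last by move: #|A|; clear; lia.
apply: leq_trans (leq_mul (leqnn _) h1).
move: lec lew leb z_gt0; move: #|A|; clear => a; lia.
Qed.

(** * Counting non-adjacent pairs *)

Let NN := \sum_(x : G) #|~: nbhd x|.
Let inner := \sum_i \sum_(x in V i) #|V i :&: nbhd x|.
Let miss := \sum_(d in D) #|~: D :\: nbhd d|.

Lemma D_lower x : x \in D -> 1 + #|~: D :\: nbhd x| <= #|~: nbhd x|.
Proof.
move=> xD; have -> : 1 + #|~: D :\: nbhd x| = #|x |: (~: D :\: nbhd x)|.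
  by rewrite cardsU1 in_setD [x \in ~: D]in_setC xD andbF.
apply/subset_leq_card/subsetP => y; rewrite !inE => /orP[/eqP->|/andP[]//].
by rewrite sedge_irrefl.
Qed.

Lemma V_lower i x : x \in V i ->
  #|V i| + #|D :\: nbhd x| <= #|~: nbhd x| + #|V i :&: nbhd x|.
Proof.
move=> xV; rewrite -(cardsID (nbhd x) (V i)) -addnA addnC leq_add2r.
have -> : #|V i :\: nbhd x| + #|D :\: nbhd x| = #|(V i :\: nbhd x) :|: (D :\: nbhd x)|.
  rewrite cardsU (_ : _ :&: _ = set0) ?cards0 ?subn0 //.
  apply/setP => y; rewrite in_setI !in_setD in_set0.
  by case yV: (y \in V i); rewrite ?andbF // (negPf (V_notin_D yV)) !andbF.
by apply/subset_leq_card/subsetP => y; rewrite !inE => /orP[]/andP[].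
Qed.

Lemma sum_outside_D (F : G -> nat) : \sum_(x in ~: D) F x = \sum_i \sum_(x in V i) F x.
Proof. by rewrite /D setCK partition_disjoint_bigcup //; apply: V_dis. Qed.

Lemma sum_card_V : \sum_i #|V i| = #|G| - #|D|.
Proof.
rewrite -(cardsC D) addKn -sum1_card sum_outside_D.
by apply: eq_bigr => i _; rewrite sum1_card.
Qed.

(** [NN] counts ordered pairs with the diagonal, whence the term [#|D|]; [miss] enters once from [D]
    and once from the classes. *)
Lemma missing_lower : #|D| + 2 * miss + \sum_i #|V i| ^ 2 <= NN + inner.
Proof.
have -> : NN = \sum_(x in D) #|~: nbhd x| + \sum_(x in ~: D) #|~: nbhd x|.
  rewrite /NN (bigID (mem D)) /=; congr (_ + _); apply: eq_bigl => x.
  by rewrite in_setC.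
have h1 : #|D| + miss <= \sum_(x in D) #|~: nbhd x|.
  by rewrite -sum1_card -big_split; apply: leq_sum => x /D_lower.
have h2 : miss + \sum_i #|V i| ^ 2 <= \sum_(x in ~: D) #|~: nbhd x| + inner.
  rewrite /miss double_countN !sum_outside_D -!big_split; apply: leq_sum => i _.
  rewrite -mulnn -sum_nat_const -!big_split; apply: leq_sum => x /V_lower /=.
  by rewrite addnC.
by rewrite mul2n -addnn addnA -addnA -[leqRHS]addnA leq_add.
Qed.

Lemma main_ineq : #|G| + 2 * turan_missing p (#|G| - #|D|) + 2 * miss <= NN + inner.
Proof.
apply: leq_trans missing_lower; have := sum_squares_ge p_gt0 sum_card_V => /=.
by have := max_card D; move: miss (turan_missing _ _) (\sum_i #|V i| ^ 2); clear; lia.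
Qed.

Hypotheses (leAG : #|A| <= #|G|) (cE : c = ((#|G| - #|A|) %/ p).+1).
Hypothesis dense : NN <= #|G| + 2 * turan_missing p (#|G| - #|A| + 1).

(** Each vertex too many in [D] costs almost [2 * c] missing pairs by [miss_lower] and saves at most
    [c - 1] in the Turán term; too few of them raise the Turán term by at least [c - 1]. Neither can
    be repaid by [inner], which is at most [2 * w]. *)
Lemma card_D : #|D| = #|A| - 1.
Proof.
have I2 : inner <= 2 * w := inner_sum_le.
have M := leq_trans main_ineq (leq_add dense (leqnn inner)).
have w0 : 0 < w by move: z_gt0 lezw; clear; lia.
have [ltD|leD] := leqP #|A| #|D|.
  have m1 : (#|D|.+1 - #|A|) * (#|Uu| - z) <= miss.
    apply: leq_trans (miss_lower (subxx _) _) _; first by rewrite ltD ltnW // card_D_lt.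
    apply: leq_sum => d _; apply/subset_leq_card/setSD/bigcupsP => i _.
    by apply/subsetP => u /(subsetP (U_sub_V i)) /V_notin_D; rewrite in_setC.
  have t1 : turan_missing p (#|G| - #|A| + 1) <=
      turan_missing p (#|G| - #|D|) + (#|D|.+1 - #|A|) * (c - 1).
    have e1 : #|G| - #|A| + 1 = #|G| - #|D| + (#|D|.+1 - #|A|).
      by move: ltD leAG (max_card D); clear; lia.
    rewrite e1 cE subn1 /=; apply: turan_missing_addl.
    by rewrite -e1 addn1.
  have k1 : c - 1 + 2 * w <= #|Uu| - z by move: card_Uu leb lew lec; move: #|Uu|; clear; lia.
  have k2 : 1 * w <= (#|D|.+1 - #|A|) * w by rewrite leq_mul2r subn_gt0 ltnS ltD orbT.
  have k3 := leq_mul (leqnn (#|D|.+1 - #|A|)) k1; rewrite mulnDr in k3.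
  move: k3 k2 m1 t1 M I2 w0; move: (#|D|.+1 - #|A|) (c - 1) (#|Uu| - z) => K C X.
  by move: (turan_missing _ _) (turan_missing _ _) inner miss w; clear; lia.
apply/eqP; rewrite eqn_leq; apply/andP; split; first by move: leD; clear; lia.
rewrite leqNgt; apply/negP => lt.
have t1 : turan_missing p (#|G| - #|A| + 1) + (c - 1) <= turan_missing p (#|G| - #|D|).
  have e1 : #|G| - #|D| = #|G| - #|A| + 1 + (#|A| - 1 - #|D|).
    by move: lt leAG; clear; lia.
  rewrite e1; apply: leq_trans (turan_missing_addr _ _ _); rewrite leq_add2l.
  rewrite cE subn1 /=; apply: (@leq_trans (1 * ((#|G| - #|A| + 1) %/ p))).
    by rewrite mul1n leq_div2r // leq_addr.
  by rewrite leq_mul2r subn_gt0 lt orbT.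
by move: t1 M I2 w0 lec; move: (turan_missing _ _) (turan_missing _ _) inner miss; clear; lia.
Qed.

(** With [#|D|] known, the Turán terms in [main_ineq] and [dense] cancel and leave
    [2 * miss <= inner]. *)
Lemma D_miss l d : d \in D -> #|U l :\: nbhd d| <= w.
Proof.
move=> dD; have I2 : inner <= 2 * w := inner_sum_le.
have M := leq_trans main_ineq (leq_add dense (leqnn inner)).
have e1 : #|G| - #|D| = #|G| - #|A| + 1.
  by rewrite card_D; move: A_gt0 leAG; clear; lia.
have : miss <= w.
  by rewrite e1 in M; move: M I2; move: (turan_missing _ _) inner miss; clear; lia.
apply: leq_trans; rewrite /miss (bigD1 d) //=; apply: leq_trans (leq_addr _ _).
apply/subset_leq_card/setSD/subsetP => u /(subsetP (U_sub_V l)) /V_notin_D.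
by rewrite in_setC.
Qed.

(* All of [A] but [a0] is sent to [D]. *)
Lemma embed_last (a0 : T) (v0 : G) (k : T -> 'I_p) (R : T -> {set G}) (J : T -> {set 'I_p}) :
  a0 \in A -> v0 \notin D ->
  (forall b, a0 -- b ->
     [/\ clique (v0 |: R b), v0 \notin R b, #|R b| + #|J b| = p - 1, #|R b| <= 2 &
         [disjoint R b & D]]) ->
  (forall b, a0 -- b -> k b \notin J b /\
     forall l, l \in k b |: J b -> {in v0 |: R b, forall x, #|U l :\: nbhd x| <= w}) ->
  (forall b b', a0 -- b -> a0 -- b' -> b != b' -> [disjoint R b & R b']) -> False.
Proof.
move=> a0A v0D hR hk Rdis; apply: free.
have [|g0 [g0inj g0D]] := @injection_into T G v0 (A :\ a0) D _.
  by rewrite card_D (cardsD1 a0 A) a0A addKn.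
pose g a := if a == a0 then v0 else g0 a.
have gD a : a \in A -> a != a0 -> g a \in D.
  by move=> aA na; rewrite /g (negPf na) g0D // !inE na.
have ginj : {in A &, injective g}.
  move=> a a' aA a'A; have := gD a aA; have := gD a' a'A; rewrite /g.
  have [->|na] := eqVneq a a0; have [->|na'] := eqVneq a' a0 => //.
  - by move=> /(_ isT) h _ E; rewrite E h in v0D.
  - by move=> _ /(_ isT) h E; rewrite -E h in v0D.
  - by move=> _ _; apply: g0inj; rewrite !inE ?na ?na'.
(* A neighbour of [a0] must see, besides [D], also [v0] and the vertices reserved for its clique. *)
pose Z b1 := if a0 -- b1 then v0 |: R b1 else set0.
pose RR := \bigcup_(b1 | a0 -- b1) R b1.
have RRsub b1 : a0 -- b1 -> R b1 \subset RR by move=> ab; apply: (bigcup_sup b1).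
have cRR : #|RR| <= #|T| * 2.
  apply: leq_trans (card_bigcup_le _ _) _.
  apply: (@leq_trans (\sum_(b1 | a0 -- b1) 2)); first by apply: leq_sum => b1 /hR[].
  by rewrite sum_nat_const leq_mul2r max_card.
pose cand b1 := (U (k b1) :&: common (D :|: Z b1)) :\: RR.
have cand_big b1 : #|T| <= #|cand b1|.
  have : w + w <= #|U (k b1) :&: common (D :|: Z b1)|.
    apply: big_common => [x /setUP[/D_miss//|]|].
      by rewrite /Z; case: ifP => [/hk[_ h] | _]; [apply: h; rewrite !inE eqxx | rewrite inE].
    apply: leq_trans (leq_card_setU _ _) _.
    have : #|Z b1| <= 3.
      rewrite /Z; case: ifP => [/hR[_ _ _ le2 _]|_]; last by rewrite cards0.
      by rewrite cardsU1; move: le2; case: (_ \notin _); move: #|R b1|; clear; lia.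
    by rewrite card_D; move: leAT; move: #|Z b1|; clear; lia.
  rewrite /cand cardsD => h; rewrite -(leq_add2r #|RR|); apply: (@leq_trans (#|T| + #|T| * 2)).
    by rewrite leq_add2l.
  have := subset_leq_card (subsetIr (U (k b1) :&: common (D :|: Z b1)) RR).
  by move: h leTz leb lew; move: #|_ :&: RR| #|_ :&: _| #|RR|; clear; lia.
have candP b1 y : y \in cand b1 -> [/\ y \in U (k b1), y \in common (D :|: Z b1) & y \notin RR].
  by case/setDP=> /setIP[].
have y_miss b1 y l : y \in cand b1 -> l != k b1 -> #|U l :\: nbhd y| <= w.
  by case/candP=> yU _ _ nl; apply: (@leq_trans (2 * z)) => //; apply: U_miss yU; rewrite eq_sym.
(* Cliques meeting [D] need no reserved vertices: they draw on all classes but the one of their end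
   in [B]. *)
apply: (@blowup_from_A T G A B p hAB p_gt0 g cand _ U (2 * z)
  (fun a b1 => if a == a0 then R b1 else set0)
  (fun a b1 => if a == a0 then J b1 else ~: [set k b1]) ginj).
- by move=> b1' _; apply: cand_big.
- by move=> i j u; apply: U_miss.
- move=> a b1' aA bB; have [->|na] := eqVneq a a0 => ab.
    have [r1 r2 r3 r4 r5] := hR _ ab; have [k1 k2] := hk _ ab.
    have Zb : Z b1' = v0 |: R b1' by rewrite /Z ab.
    have g00 : g a0 = v0 by rewrite /g eqxx.
    rewrite g00; split=> //.
    + move=> x xA; have [->|nx] := eqVneq x a0; first by rewrite g00.
      by apply/negP => xR; have := disjointFr r5 xR; rewrite gD.
    + move=> b1'' _; rewrite disjoints_subset; apply/subsetP => x xR; rewrite in_setC.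
      by apply/negP => /candP[_ _ /negP[]]; apply: (subsetP (RRsub _ ab)).
    + move=> y yc; have [yU /commonP yZ _] := candP _ _ yc; split.
        by apply/commonP => x xZ; apply: yZ; rewrite inE Zb xZ orbT.
      move=> l lJ; apply: leq_trans room_ltw _; apply: big_common => [x|].
        have lk : l != k b1' by apply: contraTneq lJ => ->.
        have h := k2 l; rewrite inE lJ orbT in h.
        case/setU1P => [->|/setU1P[->|xR]]; [|exact: y_miss yc lk|].
          by apply: h => //; rewrite !inE eqxx.
        by apply: h => //; rewrite inE xR orbT.
      rewrite !cardsU1; move: r4; do 2!case: (_ \notin _); move: #|R b1'|; clear; lia.
  rewrite cards0 cardsC1 card_ord subn1 setU0; split=> //.
  + exact: clique1.
  + by move=> x _; rewrite inE.
  + by move=> b1'' _; rewrite -setI_eq0 set0I.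
  + move=> y yc; have [yU /commonP yZ _] := candP _ _ yc; split.
      by apply/commonP => x /set1P->; apply: yZ; rewrite inE gD.
    move=> l; rewrite !inE setU0 => nl; apply: leq_trans room_ltw _; apply: big_common.
      by move=> x /set2P[]->; [apply: D_miss; apply: gD | apply: y_miss yc nl].
    by rewrite cards2; case: (_ != _); clear; lia.
- move=> a b2 a' b3 _ _ ab _ _ ab' nab.
  case: (eqVneq a a0) => [E|_]; last by rewrite -setI_eq0 set0I.
  case: (eqVneq a' a0) => [E'|_]; last by rewrite -setI_eq0 setI0.
  by subst a a'; apply: Rdis => //; apply: contraNneq nab => ->.
Qed.

(** * Edges inside a class *)

Lemma V_far i j v : v \in V i -> j != i -> #|U j :\: nbhd v| <= w.
Proof. by move=> vi nji; apply: V_miss vi; rewrite eq_sym. Qed.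

Lemma U_far i j v : v \in U i -> j != i -> #|U j :\: nbhd v| <= w.
Proof. by move/(subsetP (U_sub_V i)); apply: V_far. Qed.

Lemma pick_common j (Z : {set G}) : {in Z, forall x, #|U j :\: nbhd x| <= w} -> #|Z| <= 4 ->
  exists v, v \in U j /\ {in Z, forall x, v -- x}.
Proof.
move=> hZ cZ; have : 0 < #|U j :&: common Z|.
  apply: leq_trans (big_common hZ _); first by move: z_gt0 lezw; clear; lia.
  by apply: leq_trans cZ _; clear; lia.
case/card_gt0P => v /setIP[vU /commonP vc]; exists v; split=> // x xZ.
by rewrite edgeC; apply: vc.
Qed.

Lemma cards2_le (x y : G) : #|[set x; y]| <= 2.
Proof. by rewrite cards2; case: (_ != _). Qed.

Lemma clique_edge (x y : G) : x -- y -> clique [set x; y].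
Proof. by move=> xy u v /set2P[]-> /set2P[]->; rewrite ?eqxx // edgeC. Qed.

Lemma clique_cons (v : G) (S : {set G}) : {in S, forall x, v -- x} -> clique S -> clique (v |: S).
Proof. by move=> h cS; apply: cliqueU => // [|x y /set1P-> yS _]; [apply: clique1|apply: h]. Qed.

Lemma edge_disjoint_D i x y : x \in V i -> y \in V i -> [disjoint [set x; y] & D].
Proof.
by move=> xi yi; rewrite disjoints_subset subUset !sub1set [x \in _]in_setC [y \in _]in_setC
  (V_notin_D xi) (V_notin_D yi).
Qed.

Lemma far_edge i l x y : x \in V i -> y \in V i -> l != i ->
  {in [set x; y], forall u, #|U l :\: nbhd u| <= w}.
Proof. by move=> xi yi nl u /set2P[]->; [apply: V_far xi nl|apply: V_far yi nl]. Qed.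

Lemma no_inner_edge i x y : (exists2 a, a \in A & leaf a) ->
  x \in V i -> y \in V i -> ~ x -- y.
Proof.
move=> [a0 a0A /cards1P[b0 a0b]] xi yi xy.
have nb b' : a0 -- b' -> b' = b0.
  by move=> ab; apply/set1P; rewrite -a0b inE.
have [j [nji _]] := third_class i i; have [k [nki nkj]] := third_class i j.
have [v0 [v0j v0xy]] := pick_common (far_edge xi yi nji) (leq_trans (cards2_le x y) (isT : 2 <= 4)).
have v0V := subsetP (U_sub_V j) _ v0j.
apply: (@embed_last a0 v0 (fun=> k) (fun=> [set x; y]) (fun=> ~: [set i; j; k])) => //.
- exact: V_notin_D v0V.
- move=> b' _; split.
  + exact: clique_cons v0xy (clique_edge xy).
  + by apply/negP => /v0xy; rewrite sedge_irrefl.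
  + rewrite cards2 (edge_neq xy) card_others3 //; try by rewrite eq_sym.
    by move: p_ge3; clear; lia.
  + exact: cards2_le.
  + exact: edge_disjoint_D xi yi.
- move=> b' _; split; first by rewrite !inE eqxx orbT.
  move=> l; rewrite !inE !negb_or -andbA => /orP hl u.
  have [li lj] : l != i /\ l != j by case: hl => [/eqP->//|/and3P[]].
  by case/setU1P => [->|]; [apply: U_far v0j lj | exact: (far_edge xi yi li)].
- by move=> b1 b2 /nb-> /nb->; rewrite eqxx.
Qed.

(** Here [a0] goes to [x], and the two cliques at [a0] use [y1] and [y2]. Both neighbours of [a0] go
    to class [k], and the other [p - 2] classes complete the cliques. *)
Lemma no_inner_path a0 i x y1 y2 : a0 \in A -> degree a0 = 2 ->
  x \in V i -> y1 \in V i -> y2 \in V i -> x -- y1 -> x -- y2 -> y1 != y2 -> False.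
Proof.
move=> a0A /eqP/cards2P[b1 [b2 [nb12 a0b]]] xi y1i y2i xy1 xy2 ny.
have nb b' : a0 -- b' -> b' = b1 \/ b' = b2.
  by move=> ab; apply/set2P; rewrite -a0b inE.
have [k [nki _]] := third_class i i.
pose y b' := if b' == b1 then y1 else y2.
have yi b' : y b' \in V i by rewrite /y; case: ifP.
have xy b' : x -- y b' by rewrite /y; case: ifP.
apply: (@embed_last a0 x (fun=> k) (fun b' => [set y b']) (fun=> ~: [set i; k])) => //.
- exact: V_notin_D xi.
- move=> b' _; split.
  + exact: clique_edge.
  + by rewrite inE edge_neq.
  + by rewrite cards1 card_others2; [move: p_ge3; clear; lia | rewrite eq_sym].
  + by rewrite cards1.
  + by rewrite disjoints_subset sub1set [_ \in ~: _]in_setC (V_notin_D (yi b')).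
- move=> b' _; split; first by rewrite !inE eqxx orbT.
  move=> l; rewrite !inE negb_or => /orP hl u /(far_edge xi (yi b')); apply.
  by case: hl => [/eqP->//|/andP[]].
- move=> b' b'' /nb h /nb h' nbb; rewrite disjoints_subset sub1set !inE /y.
  by case: h h' nbb => -> [] ->; rewrite ?eqxx // [b2 == b1]eq_sym (negPf nb12) // eq_sym.
Qed.

(** Here [a0] goes to a common neighbour of both edges in another class [j], and each clique at [a0]
    contains one of the edges. *)
Lemma no_inner_disjoint a0 i l x1 y1 x2 y2 : a0 \in A -> degree a0 = 2 ->
  x1 \in V i -> y1 \in V i -> x1 -- y1 -> x2 \in V l -> y2 \in V l -> x2 -- y2 ->
  [disjoint [set x1; y1] & [set x2; y2]] -> False.
Proof.
move=> a0A /eqP/cards2P[b1 [b2 [nb12 a0b]]] x1i y1i xy1 x2l y2l xy2 dis.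
have nb b' : a0 -- b' -> b' = b1 \/ b' = b2.
  by move=> ab; apply/set2P; rewrite -a0b inE.
have [j [nji njl]] := third_class i l.
pose ix b' := if b' == b1 then i else l.
pose x b' := if b' == b1 then x1 else x2.
pose y b' := if b' == b1 then y1 else y2.
have xV b' : x b' \in V (ix b') by rewrite /x /ix; case: ifP.
have yV b' : y b' \in V (ix b') by rewrite /y /ix; case: ifP.
have xy b' : x b' -- y b' by rewrite /x /y; case: ifP.
have nj b' : j != ix b' by rewrite /ix; case: ifP.
(* The two edges may lie in different classes, so the class receiving [b'] is chosen separately for
   each. *)
have exk b' : exists k, (k != ix b') && (k != j).
  by have [k [h1 h2]] := third_class (ix b') j; exists k; rewrite h1.
pose k b' := xchoose (exk b').
have kP b' : k b' != ix b' /\ k b' != j by apply/andP; exact: (xchooseP (exk b')).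
have [||v0 [v0j v0xy]] := @pick_common j ([set x1; y1] :|: [set x2; y2]).
- by move=> u /setUP[]; [apply: (far_edge x1i y1i nji) | apply: (far_edge x2l y2l njl)].
- apply: leq_trans (leq_card_setU _ _) _; exact: leq_add (cards2_le _ _) (cards2_le _ _).
have v0V := subsetP (U_sub_V j) _ v0j.
have v0R b' : {in [set x b'; y b'], forall u, v0 -- u}.
  by move=> u uR; apply: v0xy; move: uR; rewrite /x /y; case: ifP => _ uR; rewrite inE uR ?orbT.
apply: (@embed_last a0 v0 k (fun b' => [set x b'; y b'])
  (fun b' => ~: [set ix b'; j; k b'])) => //.
- exact: V_notin_D v0V.
- move=> b' _; have [n1 n2] := kP b'; split.
  + exact: clique_cons (v0R b') (clique_edge (xy b')).
  + by apply/negP => /v0R; rewrite sedge_irrefl.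
  + rewrite cards2 (edge_neq (xy b')) card_others3 //; try by rewrite eq_sym.
    by move: p_ge3; clear; lia.
  + exact: cards2_le.
  + exact: edge_disjoint_D (xV b') (yV b').
- move=> b' _; have [n1 n2] := kP b'; split; first by rewrite !inE eqxx orbT.
  move=> m; rewrite !inE !negb_or -andbA => /orP hl u.
  have [li lj] : m != ix b' /\ m != j by case: hl => [/eqP->//|/and3P[]].
  case/setU1P => [->|]; first exact: U_far v0j lj.
  exact: (far_edge (xV b') (yV b') li).
- have E1 : [set x b1; y b1] = [set x1; y1] by rewrite /x /y eqxx.
  have E2 : [set x b2; y b2] = [set x2; y2] by rewrite /x /y eq_sym (negPf nb12).
  by move=> b' b'' /nb[]-> /nb[]->; rewrite ?eqxx // E1 E2 // disjoint_sym.
Qed.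

(** Distinct edges are disjoint, or share a vertex and then lie in one class; both patterns are
    excluded. *)
Lemma inner_edge_unique a0 i l x1 y1 x2 y2 : a0 \in A -> degree a0 = 2 ->
  x1 \in V i -> y1 \in V i -> x1 -- y1 -> x2 \in V l -> y2 \in V l -> x2 -- y2 ->
  [set x1; y1] = [set x2; y2].
Proof.
move=> a0A d2 x1i y1i xy1 x2l y2l xy2.
have [dis|] := boolP [disjoint [set x1; y1] & [set x2; y2]].
  by case: (no_inner_disjoint a0A d2 x1i y1i xy1 x2l y2l xy2 dis).
rewrite -setI_eq0 => /set0Pn[u /setIP[u1 u2]].
have Eil : i = l.
  apply/eqP; apply/negPn/negP => nil.
  have ui : u \in V i by case/set2P: u1 => ->.
  by have := V_notin nil ui; case/set2P: u2 => ->; rewrite ?x2l ?y2l.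
subst l; apply/eqP; apply/negPn/negP => ne.
have path x y y' : x \in V i -> y \in V i -> y' \in V i -> x -- y -> x -- y' -> y = y'.
  move=> h1 h2 h3 h4 h5; apply/eqP; apply/negPn/negP => h.
  exact: (no_inner_path a0A d2 h1 h2 h3 h4 h5 h).
move/negP: ne; apply; apply/eqP.
have xy1' : y1 -- x1 by rewrite edgeC.
have xy2' : y2 -- x2 by rewrite edgeC.
case/set2P: u1 => Eu; case/set2P: u2 => Eu'; subst u.
- by move: xy1; rewrite Eu' => h; rewrite (path _ _ _ x2l y1i y2l h xy2).
- by move: xy1; rewrite Eu' => h; rewrite (path _ _ _ y2l y1i x2l h xy2') setUC.
- by move: xy1'; rewrite Eu' => h; rewrite (path _ _ _ x2l x1i y2l h xy2) setUC.
- by move: xy1'; rewrite Eu' => h; rewrite (path _ _ _ y2l x1i x2l h xy2').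
Qed.

(** * Equality in the count *)

Let i0 : 'I_p := Ordinal p_gt0.
(** Vertices of [D] lie in no [V i] and get the default [i0]. *)
Let cl x : 'I_p := odflt i0 [pick i | x \in V i].

Lemma cl_V i x : x \in V i -> cl x = i.
Proof.
move=> xi; rewrite /cl; case: pickP => [j xj|/(_ i)]; last by rewrite xi.
by apply/eqP/negPn/negP => nji; have := V_notin nji xj; rewrite xi.
Qed.

Lemma V_cl x : x \notin D -> x \in V (cl x).
Proof. by case/notin_D => i xi; rewrite (cl_V xi). Qed.

Lemma in_V i x : (x \in V i) = (x \notin D) && (cl x == i).
Proof.
apply/idP/andP => [xi|[xD /eqP<-]]; last exact: V_cl.
by rewrite (V_notin_D xi) (cl_V xi).
Qed.

Section Equality.
Variable eps : nat.
Hypothesis dense_eps : NN + 2 * eps <= #|G| + 2 * turan_missing p (#|G| - #|A| + 1).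
Hypothesis inner_eps : inner <= 2 * eps.

Let sizeE : #|G| - #|D| = #|G| - #|A| + 1.
Proof. by rewrite card_D; move: A_gt0 leAG; clear; lia. Qed.

(** The lower bound in [main_ineq] meets the two hypotheses on [eps] exactly and leaves no slack.
    The value of [eps] will be [0] in the leaf case and [1] in the case of degree two. *)
Let miss0 : miss = 0.
Proof.
have := main_ineq; rewrite sizeE => M; move: M dense_eps inner_eps.
by move: (turan_missing _ _) inner miss NN; clear; lia.
Qed.

Lemma classes_balanced i j : #|V i| <= #|V j|.+1.
Proof.
apply: (balanced_of_sum_squares p_gt0 sum_card_V (m := fun i => #|V i|)).
have := missing_lower; rewrite miss0 sizeE; move: dense_eps inner_eps (max_card D) sizeE.
by move: (turan_missing _ _) inner NN (\sum_i #|V i| ^ 2); clear; lia.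
Qed.

(** The bounds [D_lower] and [V_lower] hold at each vertex and their sums agree, so each of them is
    an equality. *)
Lemma pointwise_tight x : #|~: nbhd x| + (if x \in D then 0 else #|V (cl x) :&: nbhd x|) <=
  if x \in D then 1 else #|V (cl x)| + #|D :\: nbhd x|.
Proof.
pose f x := if x \in D then 1 + #|~: D :\: nbhd x| else #|V (cl x)| + #|D :\: nbhd x|.
pose g x := #|~: nbhd x| + (if x \in D then 0 else #|V (cl x) :&: nbhd x|).
have fg y : f y <= g y.
  rewrite /f /g; case: ifPn => yD; first by rewrite addn0 D_lower.
  exact: V_lower (V_cl yD).
have split_sum (h1 h2 : G -> nat) : \sum_x (if x \in D then h1 x else h2 x) =
    \sum_(x in D) h1 x + \sum_(x in ~: D) h2 x.
  rewrite (bigID (mem D)) /=; congr (_ + _); last under eq_bigl => y do rewrite -in_setC.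
    by apply: eq_bigr => y ->.
  by apply: eq_bigr => y; rewrite [y \in _]in_setC => /negPf->.
have sg : \sum_x g x = NN + inner.
  rewrite big_split /= split_sum [X in _ + (X + _)]big1 // add0n sum_outside_D; congr (_ + _).
  by apply: eq_bigr => i _; apply: eq_bigr => y /cl_V->.
have sf : \sum_x f x = #|D| + 2 * miss + \sum_i #|V i| ^ 2.
  have e2 : \sum_(x in ~: D) #|V (cl x)| = \sum_i #|V i| ^ 2.
    rewrite sum_outside_D; apply: eq_bigr => i _.
    by rewrite -mulnn -sum_nat_const; apply: eq_bigr => y /cl_V->.
  have e3 : \sum_(x in ~: D) #|D :\: nbhd x| = miss by rewrite /miss double_countN.
  rewrite split_sum !big_split /= sum1_card e2 e3 -/miss.
  by move: (\sum_i #|V i| ^ 2) miss; clear; lia.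
have le : \sum_x g x <= \sum_x f x.
  rewrite sg sf miss0; have := sum_squares_ge p_gt0 sum_card_V => /=; rewrite sizeE.
  move: dense_eps inner_eps (max_card D) sizeE.
  by move: (turan_missing _ _) inner NN (\sum_i #|V i| ^ 2); clear; lia.
have := sum_leq_pointwise fg le x; rewrite /f /g; case: ifP => // xD.
have /eqP := miss0; rewrite /miss sum_nat_eq0 => /forall_inP/(_ x xD)/eqP->.
by rewrite !addn0.
Qed.

Lemma D_adjacent x y : x \in D -> x != y -> x -- y.
Proof.
move=> xD nxy; have := pointwise_tight x; rewrite xD addn0 => le1.
apply/negPn/negP => nxy'; have : #|[set x; y]| <= 1.
  apply: leq_trans le1; apply/subset_leq_card; rewrite subUset !sub1set !in_setC !in_nbhd.
  by rewrite sedge_irrefl.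
by rewrite cards2 nxy.
Qed.

Lemma cross_adjacent x y : x \notin D -> y \notin D -> cl x != cl y -> x -- y.
Proof.
move=> xD yD ncl; have := pointwise_tight x; rewrite (negPf xD).
have -> : D :\: nbhd x = set0.
  apply/eqP; rewrite setD_eq0; apply/subsetP => d dD; rewrite in_nbhd edgeC.
  by apply: D_adjacent => //; apply: contraNneq xD => <-.
rewrite cards0 addn0 => le1; have eqV := cardsID (nbhd x) (V (cl x)).
apply/negPn/negP => nxy.
have : #|y |: (V (cl x) :\: nbhd x)| <= #|~: nbhd x|.
  apply/subset_leq_card; rewrite subUset sub1set in_setC in_nbhd nxy.
  by rewrite setDE subsetIr.
rewrite cardsU1 in_setD [y \in V _]in_V yD eq_sym (negPf ncl) andbF /=.
by move: le1 eqV; move: #|V _| #|_ :&: _| #|_ :\: _| #|~: _|; clear; lia.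
Qed.

End Equality.

Lemma equality_case eps :
  NN + 2 * eps <= #|G| + 2 * turan_missing p (#|G| - #|A| + 1) -> inner <= 2 * eps ->
  [/\ forall i j, #|[set x | (x \notin D) && (cl x == i)]| <=
      #|[set x | (x \notin D) && (cl x == j)]|.+1 &
    forall x y, x != y -> x \in D \/ y \in D \/ cl x != cl y -> x -- y].
Proof.
move=> h1 h2; have VE i : [set x | (x \notin D) && (cl x == i)] = V i.
  by apply/setP => x; rewrite in_V inE.
split=> [i j|x y nxy h]; first by rewrite !VE (classes_balanced h1 h2).
have [xD|xD] := boolP (x \in D); first exact: (D_adjacent h1 h2).
have [yD|yD] := boolP (y \in D).
  by rewrite edgeC; apply: (D_adjacent h1 h2) => //; rewrite eq_sym.
by apply: (cross_adjacent h1 h2) => //; case: h => [|[]]; rewrite ?(negPf xD) ?(negPf yD).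
Qed.

Lemma inner_sum_cl : inner = \sum_(x in ~: D) #|V (cl x) :&: nbhd x|.
Proof.
rewrite sum_outside_D; apply: eq_bigr => i _; apply: eq_bigr => x xi.
by rewrite (cl_V xi).
Qed.

Lemma structure_leaf : (exists2 a, a \in A & leaf a) ->
  exists (D : {set G}) (cl : G -> 'I_p), [/\ #|D| = #|A| - 1,
    forall i j, #|[set x | (x \notin D) && (cl x == i)]| <=
      #|[set x | (x \notin D) && (cl x == j)]|.+1 &
    forall x y, (x -- y) = (x != y) && [|| x \in D, y \in D | cl x != cl y]].
Proof.
move=> hleaf; have inner0 : inner <= 2 * 0.
  rewrite inner_sum_cl muln0 leqn0 sum_nat_eq0; apply/forall_inP => x.
  rewrite [x \in _]in_setC => xD; rewrite cards_eq0; apply/eqP/setP => y.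
  rewrite in_set0 in_setI in_nbhd; apply/negP => /andP[yV].
  exact: no_inner_edge hleaf (V_cl xD) yV.
have dense0 : NN + 2 * 0 <= #|G| + 2 * turan_missing p (#|G| - #|A| + 1) by rewrite muln0 addn0.
have [bal adj] := equality_case dense0 inner0.
exists D, cl; split=> // [|x y]; first exact: card_D.
apply/idP/andP => [xy|[nxy /or3P h]]; last by apply: adj => //; case: h; tauto.
split; first exact: edge_neq.
case xD: (x \in D) => //=; case yD: (y \in D) => //=; apply/negP => /eqP E.
have xV := V_cl (negbT xD); have yV := V_cl (negbT yD); rewrite -E in yV.
exact: no_inner_edge hleaf xV yV xy.
Qed.

(** One edge more than in [H(n,p,s)] forces an inner edge, and [inner_edge_unique] allows no second
    one; so [inner] is at most [2], and equality holds with [eps] equal to [1]. *)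
Lemma structure_degree2 a0 : a0 \in A -> degree a0 = 2 ->
  NN + 2 <= #|G| + 2 * turan_missing p (#|G| - #|A| + 1) ->
  exists (D : {set G}) (cl : G -> 'I_p) (u v : G), [/\ #|D| = #|A| - 1,
    forall i j, #|[set x | (x \notin D) && (cl x == i)]| <=
      #|[set x | (x \notin D) && (cl x == j)]|.+1,
    [/\ u \notin D, v \notin D, u != v & cl u = cl v] &
    forall x y, (x -- y) = (x != y) &&
      [|| x \in D, y \in D, cl x != cl y | [set x; y] == [set u; v]]].
Proof.
move=> a0A d2 dense1.
have dense2 : NN + 2 * 1 <= #|G| + 2 * turan_missing p (#|G| - #|A| + 1) by rewrite muln1.
have sizeE : #|G| - #|D| = #|G| - #|A| + 1.
  by rewrite card_D; move: A_gt0 leAG; clear; lia.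
have : 0 < inner.
  have := main_ineq; rewrite sizeE; move: dense1.
  by move: (turan_missing _ _) inner NN miss; clear; lia.
rewrite inner_sum_cl lt0n sum_nat_eq0 negb_forall => /existsP[u].
rewrite negb_imply => /andP[]; rewrite [u \in _]in_setC => uD.
rewrite cards_eq0 => /set0Pn[v /setIP[vV]]; rewrite in_nbhd => uv.
have uV := V_cl uD; have vD := V_notin_D vV; have cuv := cl_V vV.
have uniq x y : x \notin D -> y \notin D -> cl x = cl y -> x -- y -> [set x; y] = [set u; v].
  move=> xD yD E xy; have xV := V_cl xD; have yV := V_cl yD; rewrite -E in yV.
  exact: inner_edge_unique a0A d2 xV yV xy uV vV uv.
have inner2 : inner <= 2 * 1.
  rewrite inner_sum_cl; apply: (@leq_trans (\sum_(x in [set u; v]) 1)); last first.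
    by rewrite sum1_card muln1 cards2_le.
  rewrite [leqRHS](bigID (mem (~: D))) /=; apply: leq_trans (leq_addr _ _).
  rewrite [leqLHS]big_mkcond [leqRHS]big_mkcond; apply: leq_sum => x _.
  rewrite [x \in ~: D]in_setC; case: ifPn => xD; last by case: ifP.
  rewrite andbT.
  have nbx y : y \in V (cl x) :&: nbhd x -> [set x; y] = [set u; v].
    case/setIP => yV; rewrite in_nbhd => xy.
    by apply: uniq => //; [apply: V_notin_D yV | rewrite (cl_V yV)].
  case: ifPn => [xuv|xuv].
    rewrite -(cards1 (if x == u then v else u)); apply/subset_leq_card/subsetP => y yh.
    have nxy : x != y by move: yh => /setIP[_]; rewrite in_nbhd => /edge_neq.
    have := set22 x y; rewrite (nbx y yh) in_set1; move: xuv; rewrite !inE.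
    case: eqVneq => [E|nxu] /=; last first.
      by move=> /eqP E; rewrite -E [y == x]eq_sym (negPf nxy) orbF.
    by move=> _; rewrite -E [y == x]eq_sym (negPf nxy).
  rewrite leqn0 cards_eq0; apply/eqP/setP => y; rewrite in_set0; apply/negP => /nbx E.
  by move/negP: xuv; apply; rewrite -E set21.
have [bal adj] := equality_case dense2 inner2.
exists D, cl, u, v; split=> //.
- exact: card_D.
- by rewrite (edge_neq uv).
move=> x y; apply/idP/andP => [xy|[nxy /or4P h]].
  split; first exact: edge_neq.
  case xD: (x \in D) => //=; case yD: (y \in D) => //=; case: eqVneq => //= E.
  by rewrite uniq ?xD ?yD.
case: h => [h|h|h|/eqP h]; try by apply: adj => //; tauto.
have xs : x \in [set u; v] by rewrite -h set21.
have ys : y \in [set u; v] by rewrite -h set22.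
clear h; case/set2P: xs nxy => ->; case/set2P: ys => ->; rewrite ?eqxx //.
by rewrite edgeC.
Qed.

End Structure.

(** * Reduction to large minimum degree *)

Definition degree_sum (G : sgraph) : nat := \sum_(x : G) #|nbhd x|.

Lemma handshake (G : sgraph) : degree_sum G = 2 * #|edges G|.
Proof.
pose P := [set xy : G * G | xy.1 -- xy.2].
have -> : degree_sum G = #|P|.
  rewrite -sum1_card (eq_bigl (fun xy : G * G => true && (xy.1 -- xy.2))); last by move=> xy; rewrite inE.
  rewrite -(pair_big_dep xpredT (fun x y : G => x -- y) (fun _ _ => 1)) /=.
  by apply: eq_bigr => x _; rewrite -sum1_card; apply: eq_bigl => y; rewrite in_nbhd.
rewrite -sum1_card (partition_big (fun xy : G * G => [set xy.1; xy.2]) (mem (edges G))) /=; last first.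
  by move=> [x y]; rewrite inE => xy; apply/edgesP; exists x, y.
rewrite mulnC -sum_nat_const; apply: eq_bigr => e /edgesP[x [y [xy ->]]].
have nxy := edge_neq xy.
transitivity #|[set (x, y); (y, x)]|; last first.
  by rewrite cards2 xpair_eqE (negPf nxy).
rewrite -sum1_card; apply: eq_bigl => [[u v]]; rewrite !inE /= !xpair_eqE.
apply/andP/orP => [[uv /eqP E]|]; last first.
  by case=> /andP[/eqP-> /eqP->]; split; rewrite // 1?edgeC // setUC.
have nuv := edge_neq uv.
have us : u \in [set x; y] by rewrite -E set21.
have vs : v \in [set x; y] by rewrite -E set22.
move: nuv; case/set2P: us => ->; case/set2P: vs => ->; rewrite !eqxx //; auto.
Qed.

Lemma degree_sum_compl (G : sgraph) : \sum_(x : G) #|~: nbhd x| + degree_sum G = #|G| ^ 2.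
Proof.
rewrite /degree_sum -big_split /= -mulnn -sum_nat_const; apply: eq_bigr => x _.
by rewrite addnC cardsC.
Qed.

Lemma contains_trans (G1 G2 G3 : sgraph) : contains G1 G2 -> contains G2 G3 -> contains G1 G3.
Proof.
move=> [f fi fh] [g gi gh]; exists (f \o g); first exact: inj_comp.
by move=> x y /gh/fh.
Qed.

Lemma isomorphic_contains (G H : sgraph) : isomorphic G H -> contains H G /\ contains G H.
Proof.
move=> [f [g fK gK] fh]; split; first by exists f => [|x y]; [apply: can_inj fK | rewrite fh].
by exists g => [|x y xy]; [apply: can_inj gK | rewrite -fh !gK].
Qed.

Lemma isomorphic_card (G H : sgraph) : isomorphic G H -> #|G| = #|H|.
Proof. by case=> f bf _; apply: bij_eq_card bf. Qed.

Lemma isomorphic_degree_sum (G H : sgraph) : isomorphic G H -> degree_sum G = degree_sum H.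
Proof.
move=> [f bf fh]; rewrite /degree_sum [RHS](reindex f) /=; last exact: onW_bij.
apply: eq_bigr => x _; rewrite -(card_imset _ (bij_inj bf)); apply: eq_card => y.
have [g fK gK] := bf; rewrite in_nbhd -[y]gK fh mem_imset; last exact: can_inj fK.
by rewrite in_nbhd.
Qed.

Section Delete.
Variables (G : sgraph) (v : G).
Definition delete_rel : rel {x in [set~ v]} := fun x y => val x -- val y.
Lemma delete_sym : symmetric delete_rel.
Proof. by move=> x y; apply: sedge_sym. Qed.
Lemma delete_irrefl : irreflexive delete_rel.
Proof. by move=> x; apply: sedge_irrefl. Qed.
Definition delete : sgraph := SGraph delete_sym delete_irrefl.

Lemma contains_delete : contains G delete.
Proof. by exists val => //; apply: val_inj. Qed.

Lemma card_delete : #|G| = #|delete|.+1.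
Proof.
by rewrite card_sig cardsC1 prednK //; apply/card_gt0P; exists v.
Qed.

Lemma degree_sum_delete : degree_sum G = degree_sum delete + 2 * #|nbhd v|.
Proof.
have dE (x : delete) : #|nbhd (val x)| = (v -- val x) + #|nbhd x|.
  rewrite (cardsD1 v (nbhd (val x))) in_nbhd edgeC; congr (_ + _).
  rewrite -(card_imset _ val_inj); apply: eq_card => y; rewrite in_setD1.
  apply/andP/imsetP => [[yv xy]|[z xz ->]].
    have yv' : y \in [set~ v] by rewrite !inE.
    rewrite in_nbhd in xy; pose z : delete := exist _ y yv'.
    by exists z => //; rewrite inE.
  by have := valP z; rewrite !inE => ->; rewrite inE in xz.
have split_v (F : G -> nat) : \sum_x F x = F v + \sum_(x : delete) F (val x).
  rewrite (bigD1 v) //=; congr (_ + _); rewrite -(big_sub [set~ v] F).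
  by apply: eq_bigl => x; rewrite !inE.
rewrite /degree_sum split_v; under eq_bigr => x _ do rewrite dE.
rewrite big_split /= addnA addnC; congr (_ + _).
have : #|nbhd v| = \sum_x (v -- x).
  by rewrite -sum1_card big_mkcond; apply: eq_bigr => x _; rewrite in_nbhd; case: (v -- x).
by rewrite split_v sedge_irrefl add0n => <-; rewrite mul2n addnn.
Qed.

End Delete.

(* With [degree_sum G = 2 e(G)], [dense p s k G] says that [G] has at least [k]
   edges more than [Hgraph #|G| p s]. *)
Definition dense (p s k : nat) (G : sgraph) : Prop :=
  #|G| ^ 2 + 2 * k <= degree_sum G + #|G| + 2 * turan_missing p (#|G| - s + 1).

(** The bound is the number of non-neighbours, itself included, of the last vertex of the Turán part
    of [H(n,p,s)], whose removal leaves [H(n-1,p,s)]. *)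
Definition high_min_degree (p s : nat) (G : sgraph) : Prop :=
  forall v : G, #|~: nbhd v| <= ((#|G| - s) %/ p).+1.

(** The deleted vertex has smaller degree than the one [H(n,p,s)] loses in passing to [n - 1], so
    the excess grows. *)
Lemma dense_delete p s k (G : sgraph) (v : G) : s < #|G| ->
  ((#|G| - s) %/ p).+1 < #|~: nbhd v| -> dense p s k G -> dense p s k.+1 (delete v).
Proof.
rewrite /dense => lt low; rewrite (degree_sum_delete v).
have := cardsC (nbhd v); rewrite (card_delete v) in lt low *.
move: (degree_sum _) #|delete v| lt low => M n lt.
have -> : n.+1 - s + 1 = (n - s + 1).+1 by move: lt; clear; lia.
have -> : n.+1 - s = n - s + 1 by move: lt; clear; lia.
rewrite turan_missingS !expnS !expn0; move: (_ %/ p) (turan_missing _ _) #|nbhd v| #|~: _|.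
clear; lia.
Qed.

Section Reduction.
Variables (p s eps m0 : nat) (L : sgraph) (Q : sgraph -> Prop).
Hypothesis s_le : s <= m0.
Hypothesis core : forall G : sgraph, m0 <= #|G| -> ~ contains G L -> high_min_degree p s G ->
  dense p s eps G -> Q G.
Hypothesis not_denser : forall G : sgraph, m0 <= #|G| -> Q G -> ~ dense p s eps.+1 G.

Lemma low_vertex (G : sgraph) : ~ high_min_degree p s G ->
  exists v : G, ((#|G| - s) %/ p).+1 < #|~: nbhd v|.
Proof.
move=> low; apply/existsP; apply: contra_notT low => /existsPn h v.
by rewrite leqNgt h.
Qed.

Lemma dense_leq k k' (G : sgraph) : k <= k' -> dense p s k' G -> dense p s k G.
Proof. by rewrite /dense => le; apply: leq_trans; rewrite leq_add2l leq_mul2l le orbT. Qed.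

Lemma delete_step (G : sgraph) k : m0 < #|G| -> ~ contains G L ->
  ~ high_min_degree p s G -> dense p s k G ->
  exists G' : sgraph, [/\ #|G| = #|G'|.+1, ~ contains G' L & dense p s k.+1 G'].
Proof.
move=> lt free /low_vertex[v low] d; exists (delete v); split.
- exact: card_delete.
- by move=> c; apply: free; apply: contains_trans (contains_delete v) c.
- by apply: dense_delete low d; apply: leq_ltn_trans lt.
Qed.

(** An excess above [eps] rules out [high_min_degree], by [core] and [not_denser]. So a vertex can
    be deleted and the excess raised, down to [m0] vertices, where the trivial bound on the degree
    sum limits it. *)
Lemma excess_bound j : forall (G : sgraph) k, #|G| = m0 + j -> ~ contains G L -> eps < k ->
  dense p s k G -> k + j <= m0 + turan_missing p (m0 - s + 1).
Proof.
elim: j => [|j IH] G k cG free ltk d.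
  move: d; rewrite /dense cG !addn0.
  by have := degree_sum_compl G; rewrite cG addn0; move: (turan_missing _ _); clear; lia.
have [||G' [cG' free' d']] := delete_step _ free _ d.
- by rewrite cG; lia.
- move=> h; apply: (@not_denser G); first by rewrite cG leq_addr.
    by apply: core => //; [rewrite cG leq_addr | apply: dense_leq d; apply: ltnW].
  exact: dense_leq d.
have := IH G' k.+1 _ free' (ltnW ltk) d'; lia.
Qed.

(** Deleting a vertex of low degree would start the process of [excess_bound] with too many
    vertices. *)
Lemma reduction (G : sgraph) : m0 + m0 + turan_missing p (m0 - s + 1) < #|G| -> ~ contains G L ->
  dense p s eps G -> Q G.
Proof.
move=> ltG free d; apply: core => //; first by lia.
move=> v; rewrite leqNgt; apply/negP => low.
have [||G' [cG' free' d']] := delete_step _ free _ d.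
- by lia.
- by move=> /(_ v); rewrite leqNgt low.
have := @excess_bound (#|G'| - m0) G' eps.+1 _ free' (leqnn _) d'; lia.
Qed.

End Reduction.

(** * The core case *)

(** [A] goes to the part [X], [B] to one of the [C i], and the new vertices to the others; distinct
    parts are fully joined, so [z] is [0]. *)
Lemma contains_of_multipartite (T G : sgraph) (A B : {set T}) p :
  bipartition A B -> 0 < #|A| -> 0 < p -> has_complete_multipartite G p (room T p 0).+1 ->
  contains G (blowup T p.+1).
Proof.
move=> hAB A0 p0 [X [C [cX cC XC CC]]].
have leT : #|T| <= room T p 0 by rewrite /room muln0 add0n leq_addr.
have leA : #|A| <= #|T| by apply: max_card.
apply: (@blowup_from_star T G A B p hAB p0 _ C 0 (Ordinal p0) X (C (Ordinal p0))).
- by rewrite card_ord.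
- move=> i j u nij ui; rewrite leqn0 cards_eq0 setD_eq0; apply/subsetP => y yj.
  by rewrite in_nbhd (CC _ _ nij).
- by apply: leq_trans cX; apply: leq_trans leA (leqW leT).
- by apply: leq_trans (cC _); apply: leqW.
- exact: leq_trans leA.
- move=> d y dX yC; split; first exact: XC yC.
  move=> j nj; rewrite (setIidPl _) //; apply/subsetP => x xj.
  by rewrite in_setI !in_nbhd (XC j) // edgeC (CC _ _ nj).
Qed.

Lemma core_partition (T : sgraph) (A B : {set T}) p :
  bipartition A B -> 0 < #|A| -> 3 <= p -> exists m0, #|A| <= m0 /\
  forall G : sgraph, m0 <= #|G| -> ~ contains G (blowup T p.+1) ->
  high_min_degree p #|A| G -> let c := ((#|G| - #|A|) %/ p).+1 in
  exists (z : nat) (U : 'I_p -> {set G}),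
  [/\ forall i j, i != j -> [disjoint U i & U j], forall i, c <= #|U i| + z,
      forall i, {in U i, forall u, #|U i :&: nbhd u| <= z} &
      [/\ #|G| <= p * c + #|A|,
        #|T| + 2 * #|T| ^ 2 * p + #|T| * 2 ^ (2 * #|T|) * p <= z &
        (2 * #|T| ^ 2 + #|T| + 20) *
          (4 * p * #|T| ^ 2 * ((2 * p + 4) * z) + 2 * ((2 * p + 4) * z)) <= c]].
Proof.
move=> hAB A0 p3; have p0 : 0 < p by apply: leq_trans p3.
(* [K * z] is the bound that [c] must reach. With [z] equal to [#|G| %/ q] it is at most
   [#|G| / (2 * p)], hence at most [c] once [#|G|] is at least [2 * #|A|]. The term [q * Z] of the
   threshold ensures that [z] is at least [Z]. *)
pose K := (2 * #|T| ^ 2 + #|T| + 20) * (4 * p * #|T| ^ 2 * (2 * p + 4) + 2 * (2 * p + 4)).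
pose q := 2 * p * K.
have q0 : 0 < q by rewrite /q /K !muln_gt0 !addn_gt0 !muln_gt0 p0 !orbT.
have [n1 Hn1] := @near_partition p (room T p 0).+1 q p0 isT q0.
pose Z := #|T| + 2 * #|T| ^ 2 * p + #|T| * 2 ^ (2 * #|T|) * p.
exists (maxn n1 (maxn (2 * #|A|) (q * Z))); split.
  by rewrite !leq_max leq_pmull // orbT.
move=> G; rewrite !geq_max => /and3P[h1 h2 h3] free hdeg c.
have pc : #|G| - #|A| < p * c by rewrite mulnC ltn_ceil.
have pc2 : p * c <= #|G| + p.
  rewrite /c mulnS addnC leq_add2r mulnC; apply: leq_trans (leq_trunc_div _ _) (leq_subr _ _).
have [|U [U1 U2 U3]] := Hn1 G c h1 hdeg pc2.
  by move/(contains_of_multipartite hAB A0 p0).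
exists (#|G| %/ q), U; split=> //.
- by move=> i; rewrite -leq_subLR leq_divRL // mulnC.
- by move=> i u ui; rewrite leq_divRL // mulnC U3.
have cG : #|G| <= p * c + #|A| by move: pc; clear; lia.
split=> //; first by rewrite leq_divRL // mulnC.
have zG : q * (#|G| %/ q) <= #|G| by rewrite mulnC leq_trunc_div.
move: (#|G| %/ q) zG => z zG.
have -> : (2 * #|T| ^ 2 + #|T| + 20) *
  (4 * p * #|T| ^ 2 * ((2 * p + 4) * z) + 2 * ((2 * p + 4) * z)) = K * z.
  by rewrite /K -[RHS]mulnA; congr (_ * _); rewrite [RHS]mulnDl -!mulnA.
rewrite -ltnS -(ltn_pmul2l p0) mulnS; apply: (@leq_ltn_trans (#|G| - #|A|)); last first.
  by move: pc; clear; lia.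
move: zG h2; rewrite /q -!mulnA; move: (p * _) => x; clear; lia.
Qed.

Definition complete_apart (G : sgraph) (p : nat) (D : {set G}) (cl : G -> 'I_p)
    (I : G -> G -> bool) :=
  forall x y : G, (x -- y) = (x != y) && [|| x \in D, y \in D, cl x != cl y | I x y].

Definition balanced (G : sgraph) (p : nat) (D : {set G}) (cl : G -> 'I_p) :=
  forall i j, #|[set x | (x \notin D) && (cl x == i)]| <= #|[set x | (x \notin D) && (cl x == j)]|.+1.

Lemma core_leaf (T : sgraph) (A B : {set T}) p :
  bipartition A B -> 0 < #|A| -> 3 <= p -> (exists2 a, a \in A & leaf a) ->
  exists m0, #|A| <= m0 /\ forall G : sgraph, m0 <= #|G| -> ~ contains G (blowup T p.+1) ->
    high_min_degree p #|A| G -> dense p #|A| 0 G ->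
    exists (D : {set G}) (cl : G -> 'I_p), [/\ #|D| = #|A| - 1, balanced D cl &
      complete_apart D cl (fun _ _ => false)].
Proof.
move=> hAB A0 p3 hleaf; have [m0 [leA Hm0]] := core_partition hAB A0 p3.
exists m0; split=> // G leG free hdeg; rewrite /dense addn0 => hd.
have [z [U [U1 U2 U3 [h1 h2 h3]]]] := Hm0 G leG free hdeg.
have [|D [cl [cD bal adj]]] :=
  structure_leaf hAB A0 p3 free hdeg U1 U2 U3 h1 h2 h3 (leq_trans leA leG) erefl _ hleaf.
  by have := degree_sum_compl G; move: hd; move: (turan_missing _ _); clear; lia.
by exists D, cl; split=> // x y; rewrite adj orbF.
Qed.

Lemma core_degree2 (T : sgraph) (A B : {set T}) p a0 :
  bipartition A B -> 0 < #|A| -> 3 <= p -> a0 \in A -> degree a0 = 2 ->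
  exists m0, #|A| <= m0 /\ forall G : sgraph, m0 <= #|G| -> ~ contains G (blowup T p.+1) ->
    high_min_degree p #|A| G -> dense p #|A| 1 G ->
    exists (D : {set G}) (cl : G -> 'I_p) (u v : G), [/\ #|D| = #|A| - 1, balanced D cl,
      [/\ u \notin D, v \notin D, u != v & cl u = cl v] &
      complete_apart D cl (fun x y => [set x; y] == [set u; v])].
Proof.
move=> hAB A0 p3 a0A d2; have [m0 [leA Hm0]] := core_partition hAB A0 p3.
exists m0; split=> // G leG free hdeg; rewrite /dense => hd.
have [z [U [U1 U2 U3 [h1 h2 h3]]]] := Hm0 G leG free hdeg.
have hN : \sum_(x : G) #|~: nbhd x| + 2 <= #|G| + 2 * turan_missing p (#|G| - #|A| + 1).
  by have := degree_sum_compl G; move: hd; move: (turan_missing _ _); clear; lia.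
by apply: (structure_degree2 hAB A0 p3 free hdeg U1 U2 U3 h1 h2 h3 (leq_trans leA leG) erefl
  _ a0A d2 hN); apply: leq_trans hN; apply: leq_addr.
Qed.

(** Elements of corresponding fibres are matched by their positions in the enumerations. *)
Lemma fiber_bijection (X Y C : finType) (f : X -> C) (g : Y -> C) :
  (forall c, #|[set x | f x == c]| = #|[set y | g y == c]|) ->
  exists h : X -> Y, bijective h /\ forall x, g (h x) = f x.
Proof.
move=> hE.
have cXY : #|X| = #|Y|.
  have fibers (Z : finType) (k : Z -> C) : #|Z| = \sum_c #|[set z | k z == c]|.
    rewrite -sum1_card (partition_big k xpredT) //=; apply: eq_bigr => c _.
    by rewrite -sum1_card; apply: eq_bigl => z; rewrite inE.
  by rewrite (fibers X f) (fibers Y g); apply: eq_bigr => c _.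
(* [nth] needs a default value in [Y], so the empty case is separate. *)
have [y0 _|noY] := pickP (@predT Y); last first.
  have Y0 : #|Y| = 0 by apply: eq_card0.
  have X0 (x : X) : False by have := fintype0 x; rewrite cXY => /(_ Y0).
  exists (fun x => match X0 x with end); split; last by move=> x; case: (X0 x).
  by apply: inj_card_bij => [x|]; [case: (X0 x) | rewrite cXY].
pose h x := nth y0 (enum [set y | g y == f x]) (index x (enum [set x' | f x' == f x])).
have lt x : index x (enum [set x' | f x' == f x]) < size (enum [set y | g y == f x]).
  by rewrite -cardE -hE cardE index_mem mem_enum inE.
have gh x : g (h x) = f x.
  by have := mem_nth y0 (lt x); rewrite mem_enum inE => /eqP.
exists h; split=> //; apply: inj_card_bij; last by rewrite cXY.
move=> x x' E; have Ef : f x = f x' by rewrite -gh E gh.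
move/eqP: E; rewrite /h Ef nth_uniq ?enum_uniq ?lt //; last by rewrite -Ef lt.
move/eqP => E; rewrite -[x](nth_index x (s := enum [set x'' | f x'' == f x'])).
  by rewrite E nth_index // mem_enum inE.
by rewrite mem_enum inE Ef.
Qed.

(** * Residue classes modulo [p] *)

Section Residues.
Variable p : nat.
Hypothesis p_gt0 : 0 < p.

Lemma count_residue a r : r < p -> \sum_(j < a * p + r) (j == r %[mod p]) = a.
Proof.
move=> ltr; elim: a => [|a IH].
  rewrite mul0n add0n big1 // => j _; rewrite !modn_small //; last exact: ltn_trans ltr.
  by rewrite ltn_eqF.
rewrite mulSn -addnA big_split_ord /= -[a in RHS]IH -add1n; congr (_ + _); last first.
  by apply: eq_bigr => j _; rewrite modnDl.
rewrite (bigD1 (Ordinal ltr)) //= eqxx big1 // => j; rewrite -val_eqE /= => nj.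
by rewrite !modn_small // (negPf nj).
Qed.

Lemma count_congruent N : \sum_(j < N) (j == N %[mod p]) = N %/ p.
Proof.
rewrite -[RHS](count_residue (N %/ p) (ltn_pmod N p_gt0)) -divn_eq.
by apply: eq_bigr => j _; rewrite modn_mod.
Qed.

(** Ties [turan_missing] to residues: [N] is congruent to [N %/ p] smaller numbers, and the diagonal
    pairs give the summand [N]. *)
Lemma congruent_pairs N :
  \sum_(i < N) \sum_(j < N) (i == j %[mod p]) = N + 2 * turan_missing p N.
Proof.
elim: N => [|N IH]; first by rewrite /turan_missing !big_ord0.
rewrite big_ord_recr /= big_ord_recr /= eqxx.
under eq_bigr => i _ do rewrite big_ord_recr /=.
rewrite big_split /= IH count_congruent turan_missingS.
under [X in _ + (X + _)]eq_bigr => j _ do rewrite eq_sym.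
by rewrite count_congruent; lia.
Qed.

Definition residue N (i : 'I_N) : 'I_p := Ordinal (ltn_pmod i p_gt0).

Lemma residueE N (i j : 'I_N) : (residue i == residue j) = (i == j %[mod p]).
Proof. by rewrite -val_eqE. Qed.

Lemma sum_residue N : \sum_r #|[set i : 'I_N | residue i == r]| = N.
Proof.
rewrite -[RHS]card_ord -sum1_card [RHS](partition_big (@residue N) xpredT) //=.
by apply: eq_bigr => r _; rewrite -sum1_card; apply: eq_bigl => i; rewrite inE.
Qed.

(** The sum of the squared class sizes counts congruent pairs, hence attains the minimum. *)
Lemma residue_balanced N i j :
  #|[set k : 'I_N | residue k == i]| <= #|[set k : 'I_N | residue k == j]|.+1.
Proof.
apply: (balanced_of_sum_squares p_gt0 (sum_residue N)).
rewrite -congruent_pairs [leqRHS](partition_big (@residue N) xpredT) //=.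
apply: leq_sum => r _; rewrite -mulnn -sum_nat_const [leqLHS]big_mkcond [leqRHS]big_mkcond.
apply: leq_sum => k _; rewrite inE; case: eqP => // <-.
rewrite -sum1_card big_mkcond; apply: leq_sum => l _; rewrite inE residueE eq_sym.
by case: (_ == _).
Qed.

End Residues.

(** * Edge count and recognition of the extremal graphs *)

Section HGraph.
Variables (n p s : nat).
Hypotheses (p_gt0 : 0 < p) (s_gt0 : 0 < s) (s_le : s <= n).
Let H := Hgraph n p s.

Lemma card_Hgraph : #|H| = n.
Proof. by rewrite card_sum !card_ord; lia. Qed.

Lemma degree_sum_Hgraph : degree_sum H + n + 2 * turan_missing p (n - s + 1) = n ^ 2.
Proof.
have := degree_sum_compl H; rewrite card_Hgraph => <-.
rewrite big_sumType /=.
have -> : \sum_(i < s - 1) #|~: nbhd (inl i : H)| = s - 1.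
  rewrite -[RHS]card_ord -sum1_card; apply: eq_bigr => i _.
  transitivity #|[set (inl i : H)]|; last exact: cards1.
  apply: eq_card => -[j|j]; rewrite !inE //=.
  by rewrite /sedge /= /complete_rel negbK eq_sym.
have -> : \sum_(i < n - s + 1) #|~: nbhd (inr i : H)| = (n - s + 1) + 2 * turan_missing p (n - s + 1).
  rewrite -(congruent_pairs p_gt0); apply: eq_bigr => i _.
  rewrite -sum1_card big_mkcond big_sumType /= big1 ?add0n; last by move=> j _; rewrite !inE.
  apply: eq_bigr => j _; rewrite !inE /= /sedge /= /turan_rel negbK.
  by case: (_ == _).
by lia.
Qed.

(** Adjacency is left out so that one bijection serves both extremal graphs: [D] goes to the
    complete part, and classes go to residue classes of the same size. *)
Lemma isomorphic_of_structure (G : sgraph) (D : {set G}) (cl : G -> 'I_p) :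
  #|G| = n -> #|D| = s - 1 -> balanced D cl ->
  exists h : G -> H, bijective h /\ forall x, match h x : 'I_(s - 1) + 'I_(n - s + 1) with
    | inl _ => is_true (x \in D)
    | inr i => x \notin D /\ forall y j, h y = inr j -> (cl x == cl y) = (i == j %[mod p]) end.
Proof.
move=> cG cD bal.
pose m' r := #|[set i : 'I_(n - s + 1) | residue p_gt0 i == r]|.
have [||f fE] := @balanced_perm p p_gt0 (fun i => #|[set x | (x \notin D) && (cl x == i)]|) m' bal.
- by move=> i j; apply: residue_balanced.
- rewrite /m' sum_residue.
  transitivity #|~: D|; last by have := cardsC D; lia.
  rewrite -sum1_card [RHS](partition_big cl xpredT) //=; apply: eq_bigr => i _.
  by rewrite -sum1_card; apply: eq_bigl => x; rewrite !inE.
(* [None] marks the universal vertices and [Some] the class, renamed by [f] to fit the sizes. *)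
pose col x := if x \in D then None else Some (f (cl x)).
pose col' (y : H) := match y with inl _ => None | inr i => Some (residue p_gt0 i) end.
have [c|h [hb hc]] := @fiber_bijection G H _ col col'.
  case: c => [r|].
    transitivity (m' r).
      rewrite -(permKV f r) -fE; apply: eq_card => x; rewrite !inE /col.
      by case: (x \in D) => //=; rewrite (inj_eq (@Some_inj _)) (inj_eq perm_inj).
    rewrite /m' -(card_imset _ (@inr_inj 'I_(s - 1) 'I_(n - s + 1))); apply: eq_card => -[i|i].
      by rewrite !inE /=; apply/imsetP => -[].
    by rewrite mem_imset ?inE //; apply: inr_inj.
  transitivity #|D|.
    by apply: eq_card => x; rewrite !inE /col; case: (x \in D).
  rewrite cD -[LHS]card_ord -(card_imset _ (@inl_inj 'I_(s - 1) 'I_(n - s + 1))).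
  apply: eq_card => -[i|i]; rewrite !inE /=; first by rewrite imset_f.
  by apply/negbTE/imsetP => -[].
exists h; split=> // x; have := hc x; case E: (h x) => [i|i] /=; rewrite /col.
  by case: (x \in D).
case xD: (x \in D) => // -[Ei]; split=> // y j Ey; have := hc y; rewrite Ey /= /col.
by case: (y \in D) => // -[Ej]; rewrite -residueE Ei Ej (inj_eq perm_inj).
Qed.

End HGraph.

Lemma isomorphic_Hgraph n p s (G : sgraph) (D : {set G}) (cl : G -> 'I_p) :
  0 < p -> 0 < s -> s <= n -> #|G| = n -> #|D| = s - 1 -> balanced D cl ->
  complete_apart D cl (fun _ _ => false) -> isomorphic G (Hgraph n p s).
Proof.
move=> p0 s0 sn cG cD bal adj; have [h [hb hP]] := isomorphic_of_structure p0 s0 sn cG cD bal.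
exists h => // x y; rewrite adj -(bij_eq hb); have := hP x; have := hP y.
case Ex: (h x) => [i|i]; case Ey: (h y) => [j|j].
- by move=> _ ->; rewrite andbT.
- by move=> _ ->.
- by move=> -> _; rewrite orbT.
move=> [/negPf-> _] [/negPf-> /(_ _ _ Ey)->] /=; rewrite orbF /sedge /= /turan_rel.
by apply/esym; case: eqVneq => //= -[->]; rewrite eqxx.
Qed.

Lemma isomorphic_Hprime n p s (G : sgraph) (D : {set G}) (cl : G -> 'I_p) (u v : G) :
  0 < p -> 0 < s -> s <= n -> #|G| = n -> #|D| = s - 1 -> balanced D cl ->
  u \notin D -> v \notin D -> u != v -> cl u = cl v ->
  complete_apart D cl (fun x y => [set x; y] == [set u; v]) -> is_Hprime n p s G.
Proof.
move=> p0 s0 sn cG cD bal uD vD nuv cuv adj.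
have [h [hb hP]] := isomorphic_of_structure p0 s0 sn cG cD bal.
have := hP u; case Eu: (h u) => [i|i]; first by rewrite (negPf uD).
have := hP v; case Ev: (h v) => [j|j]; first by rewrite (negPf vD).
move=> _ [_ /(_ _ _ Ev)]; rewrite cuv eqxx => Eij.
exists i, j; split.
- by apply: contraNneq nuv => E; rewrite -(bij_eq hb) Eu Ev E.
- by apply/eqP; rewrite -Eij.
have set2 x y : ([set h x; h y] == [set inr i; inr j]) = ([set x; y] == [set u; v]).
  rewrite -Eu -Ev -!imset_set1 -!imsetU (inj_eq (imset_inj (bij_inj hb))) //.
exists h => // x y; rewrite adj /sedge /= /add_edge_rel set2 (bij_eq hb).
have [->|nxy] := eqVneq x y; first by rewrite sedge_irrefl.
rewrite /= -(bij_eq hb) in nxy *; have := hP x; have := hP y.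
case Ex: (h x) => [a|a]; case Ey: (h y) => [b|b].
- move=> _ ->; rewrite /sedge /= /complete_rel; move: nxy; rewrite Ex Ey => nab.
  by rewrite (_ : a != b) //; apply: contraNneq nab => ->.
- by move=> _ ->.
- by move=> -> _; rewrite orbT.
by move=> [/negPf-> _] [/negPf-> /(_ _ _ Ey)->].
Qed.

Lemma degree_sum_add_edge (G : sgraph) (u v : G) : u != v -> ~~ (u -- v) ->
  degree_sum (@add_edge G u v) = degree_sum G + 2.
Proof.
move=> nuv nadj; rewrite /degree_sum.
have E (x : G) : #|nbhd (x : add_edge u v)| = #|nbhd x| + ((x == u) + (x == v)).
  have -> : nbhd (x : add_edge u v) =
      [set y : G | (x -- y) || (x == u) && (y == v) || (x == v) && (y == u)] :> {set G}.
    apply/setP => y; rewrite [LHS]inE [RHS]inE /sedge /= /add_edge_rel -orbA; congr (_ || _).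
    apply/andP/orP => [[nxy /eqP E]|].
      have xs : x \in [set u; v] by rewrite -E set21.
      have ys : y \in [set u; v] by rewrite -E set22.
      move: nxy; case/set2P: xs => ->; case/set2P: ys => ->; rewrite !eqxx //; auto.
    by case=> /andP[/eqP-> /eqP->]; split; rewrite // 1?eq_sym // setUC.
  case: (eqVneq x u) => [->|nxu].
    rewrite (negPf nuv) addn0; transitivity #|v |: nbhd u|.
      by apply: eq_card => y; rewrite !inE /= orbF orbC.
    by rewrite cardsU1 in_nbhd nadj addnC.
  case: (eqVneq x v) => [->|nxv].
    rewrite add0n; transitivity #|u |: nbhd v|.
      by apply: eq_card => y; rewrite !inE /= orbF orbC.
    by rewrite cardsU1 in_nbhd edgeC nadj addnC.
  by rewrite addn0; apply: eq_card => y; rewrite !inE !orbF.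
under eq_bigr => x _ do rewrite E.
have one (a : G) : \sum_x (x == a) = 1.
  by rewrite (bigD1 a) //= eqxx big1 ?addn0 // => x /negPf->.
by rewrite big_split /= big_split /= !one.
Qed.

(** * Vertex covers and forests *)

Section Cover.
Variables (T H : sgraph) (p : nat) (D : {set H}) (cl : H -> 'I_p) (I : rel H).
Hypothesis p_gt0 : 0 < p.
Hypothesis hadj : forall x y : H, x -- y -> [|| x \in D, y \in D, cl x != cl y | I x y].
Hypothesis hI : forall x y x' y', I x y -> I x' y' -> [set x; y] = [set x'; y'].

Let L := blowup T p.+1.

Definition edge_clique (e : {set T}) : {set L} := 
  [set v : L | match v : T + edge_type T * 'I_(p.+1 - 2) with
  | inl x => x \in e | inr (e', _) => val e' == e end].

Lemma card_edge_clique (e : edge_type T) : #|edge_clique (val e)| = p.+1.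
Proof.
have -> : edge_clique (val e) = (inl @: val e) :|: ((fun i => inr (e, i)) @: [set: 'I_(p.+1 - 2)]).
  apply/setP => -[x|[e' i]]; rewrite !inE.
    by rewrite mem_imset ?orb_idr //; [case/imsetP | move=> ? ? []].
  apply/eqP/orP => [/val_inj->|[/imsetP[]//|/imsetP[j _ [-> _]] //]].
  by right; apply/imsetP; exists i.
rewrite cardsU (_ : _ :&: _ = set0) ?cards0 ?subn0; last first.
  by apply/setP => v; rewrite !inE; apply/negP => /andP[/imsetP[x _ ->] /imsetP[]].
rewrite !card_imset ?cardsT ?card_ord; [|by move=> ? ? []|by move=> ? ? []].
have /edgesP[x [y [xy ->]]] := valP e; rewrite cards2 (edge_neq xy).
by rewrite subSS; move: p_gt0; clear; lia.
Qed.

Lemma edge_clique_adjacent (e : edge_type T) x y : x \in edge_clique (val e) ->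
  y \in edge_clique (val e) -> x != y -> x -- y.
Proof.
rewrite !inE; case: x y => [x|[e1 i]] [y|[e2 j]] /=.
- have /edgesP[u [v [uv ->]]] := valP e.
  have vu : v -- u by rewrite edgeC.
  by move=> /set2P[]-> /set2P[]->; rewrite ?eqxx.
- by move=> xe /eqP/val_inj-> _.
- by move=> /eqP/val_inj-> ye _.
move=> /eqP/val_inj-> /eqP/val_inj-> nij; rewrite /sedge /= eqxx /=.
by apply: contraNneq nij => ->.
Qed.

Lemma edge_clique_inter (e e' : edge_type T) x y : x != y ->
  x \in edge_clique (val e) -> y \in edge_clique (val e) ->
  x \in edge_clique (val e') -> y \in edge_clique (val e') -> e = e'.
Proof.
rewrite !inE; case: x y => [x|[e1 i]] [y|[e2 j]] /=.
- have /edgesP[u [v [uv E]]] := valP e; have /edgesP[u' [v' [uv' E']]] := valP e'.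
  move=> nxy xe ye xe' ye'; apply: val_inj => /=.
  have nxy' : x != y by apply: contraNneq nxy => ->.
  have two (f : {set T}) a b : f = [set a; b] -> x \in f -> y \in f -> f = [set x; y].
    move=> -> /set2P xf /set2P yf; move: nxy'.
    by case: xf => ->; case: yf => ->; rewrite ?eqxx // setUC.
  by rewrite (two _ _ _ E xe ye) (two _ _ _ E' xe' ye').
- by move=> _ _ /eqP/val_inj<- _ /eqP/val_inj<-.
- by move=> _ /eqP/val_inj<- _ /eqP/val_inj<-.
by move=> _ /eqP/val_inj<- _ /eqP/val_inj<-.
Qed.

(** A clique of the copy that avoids [D] has [p + 1] vertices in [p] classes, hence two in one
    class, joined by [I]. As [I] allows one pair only and distinct cliques share at most one vertex,
    at most one clique avoids [D]. *)
Lemma blowup_cover : contains H L -> exists C : {set T}, [/\ #|C| <= #|D|,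
  (forall a b a' b', a \notin C -> b \notin C -> a -- b -> a' \notin C -> b' \notin C ->
     a' -- b' -> [set a; b] = [set a'; b']) &
  forall a b, a \notin C -> b \notin C -> a -- b -> exists x y, I x y].
Proof.
move=> [f finj fhom].
have ex (e : edge_type T) : exists x, x \in val e.
  by have /edgesP[x [y [_ ->]]] := valP e; exists x; apply: set21.
(* A new vertex is sent to a chosen end of its edge, so an edge whose clique meets [D] has an end in
   [C]. *)
pose pi (v : L) : T := match v : T + edge_type T * 'I_(p.+1 - 2) with
  | inl x => x | inr (e, _) => xchoose (ex e) end.
pose C := pi @: (f @^-1: D).
have cC : #|C| <= #|D|.
  apply: leq_trans (leq_imset_card _ _) _; rewrite -(card_imset _ finj).
  by apply/subset_leq_card/subsetP => y /imsetP[x]; rewrite inE => xD ->.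
have piP (e : edge_type T) v : v \in edge_clique (val e) -> pi v \in val e.
  rewrite inE; case: v => [x|[e' i]] //= /eqP <-; exact: (xchooseP (ex e')).
have key a b : a \notin C -> b \notin C -> a -- b -> exists (e : edge_type T) x y,
    [/\ val e = [set a; b], x != y, x \in edge_clique (val e), y \in edge_clique (val e) & I (f x) (f y)].
  move=> aC bC ab; have he : [set a; b] \in edges T by apply/edgesP; exists a, b.
  pose e : edge_type T := exist _ [set a; b] he; have ve : val e = [set a; b] by [].
  have nD x : x \in edge_clique (val e) -> f x \notin D.
    move=> xe; apply/negP => xD; have := piP e x xe; rewrite ve.
    have : pi x \in C by rewrite imset_f // inE.
    by move=> h /set2P[] E; move: h; rewrite E; apply/negP.
  have : ~~ dinjectiveb (cl \o f) (edge_clique (val e)).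
    apply/negP => /dinjectiveP inj; have := max_card (mem ((cl \o f) @: edge_clique (val e))).
    by rewrite card_in_imset // card_edge_clique card_ord ltnn.
  case/dinjectivePn => x xe [y /andP[nxy ye] E].
  have xy : x -- y by apply: (edge_clique_adjacent xe ye); rewrite eq_sym.
  exists e, x, y; split=> //; first by rewrite eq_sym.
  by have := hadj (fhom _ _ xy); rewrite (negPf (nD _ xe)) (negPf (nD _ ye)) /= [cl _]E eqxx.
exists C; split=> // [a b a' b' h1 h2 h3 h1' h2' h3'|a b h1 h2 h3]; last first.
  by have [e [x [y [_ _ _ _ hxy]]]] := key a b h1 h2 h3; exists (f x), (f y).
have [e [x [y [<- nxy xe ye hxy]]]] := key a b h1 h2 h3.
have [e' [x' [y' [<- nxy' xe' ye' hxy']]]] := key a' b' h1' h2' h3'.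
have E : [set x; y] = [set x'; y'].
  by apply: (imset_inj finj); rewrite !imsetU !imset_set1; apply: hI.
have xs : x \in [set x'; y'] by rewrite -E set21.
have ys : y \in [set x'; y'] by rewrite -E set22.
congr val; apply: (edge_clique_inter nxy) => //.
- by case/set2P: xs => ->.
- by case/set2P: ys => ->.
Qed.

End Cover.

Section Forest.
Variable T : sgraph.
Hypothesis acyc : acyclic T.

(** Otherwise a path in [S] could be prolonged forever at its head: a neighbour of [x] other than
    the next vertex is new, or closes a cycle of length at least three. *)
Lemma forest_leaf (S : {set T}) : S != set0 -> exists2 x, x \in S & #|S :&: nbhd x| <= 1.
Proof.
move=> /set0Pn[x0 x0S]; have [/exists_inP//|none] := boolP [exists x in S, #|S :&: nbhd x| <= 1].
have deg2 x : x \in S -> 1 < #|S :&: nbhd x|.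
  by move=> xS; rewrite ltnNge; apply: contra none => le; apply/exists_inP; exists x.
have step (x : T) (s : seq T) : path (@sedge T) x s -> uniq (x :: s) -> all (mem S) (x :: s) ->
    exists x', path (@sedge T) x' (x :: s) && uniq (x' :: x :: s) && all (mem S) (x' :: x :: s).
  move=> pxs uxs Sxs; have xS : x \in S by case/andP: Sxs.
  (* For an empty [s] the default [x] is removed, which costs nothing as [x] is not adjacent to
     itself. *)
  have /card_gt0P[z] : 0 < #|(S :&: nbhd x) :\ head x s|.
    have := deg2 x xS; rewrite (cardsD1 (head x s)).
    by have := leq_b1 (head x s \in S :&: nbhd x); lia.
  rewrite in_setD1 in_setI in_nbhd => /and3P[nz zS xz].
  have nzx : z != x by rewrite eq_sym edge_neq.
  have [zs|nzs] := boolP (z \in s); last first.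
    exists z; rewrite /= in Sxs uxs *; rewrite edgeC xz pxs /= zS Sxs andbT.
    by rewrite inE negb_or nzx nzs uxs.
  case: (path.splitPr zs) pxs uxs nz => p1 p2 pxs uxs nz.
  move: pxs; rewrite cat_path /= => /andP[pp1 /andP[ez _]].
  have : uniq ((x :: rcons p1 z) ++ p2) by rewrite cat_cons cat_rcons.
  rewrite cat_uniq => /and3P[u1 _ _].
  have : ucycle (@sedge T) (x :: rcons p1 z).
    rewrite /ucycle u1 andbT /= rcons_path last_rcons edgeC xz andbT rcons_path pp1 //.
  move/acyc; rewrite /= size_rcons; case: p1 {pp1 ez u1 uxs} nz => [|y p1] //=.
  by rewrite eqxx.
have long k : exists (x : T) (s : seq T),
    [&& path (@sedge T) x s, uniq (x :: s), all (mem S) (x :: s) & size s == k].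
  elim: k => [|k [x [s /and4P[h1 h2 h3 h4]]]]; first by exists x0, [::]; rewrite /= x0S.
  have [x' /andP[/andP[h1' h2'] h3']] := step x s h1 h2 h3.
  by exists x', (x :: s); rewrite h1' h2' h3' /= eqSS.
have [x [s /and4P[_ u _ /eqP sz]]] := long #|T|.
by have := max_card (mem (x :: s)); rewrite (card_uniqP u) /= sz ltnn.
Qed.

(** Removing a vertex with at most one neighbour in [S] lowers the sum by at most [2]. *)
Lemma forest_degree_sum (S : {set T}) : S != set0 ->
  \sum_(x in S) #|S :&: nbhd x| + 2 <= 2 * #|S|.
Proof.
have [k] := ubnP #|S|; elim: k S => // k IH S leSk nS.
have [x xS le1] := forest_leaf nS.
have cS := cardsD1 x S; rewrite xS in cS.
have [E|nS'] := eqVneq (S :\ x) set0.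
  have SE : S = [set x].
    by rewrite -(setD1K xS) E setU0.
  rewrite SE big_set1 cards1 (_ : _ :&: _ = set0) ?cards0 //.
  apply/setP => y; rewrite in_setI in_set1 in_nbhd in_set0.
  by case: eqVneq => // ->; rewrite sedge_irrefl.
have {}IH := IH (S :\ x) _ nS'; rewrite cS in leSk *.
rewrite (big_setD1 x) //=.
have -> : \sum_(y in S :\ x) #|S :&: nbhd y| =
    \sum_(y in S :\ x) #|(S :\ x) :&: nbhd y| + #|S :&: nbhd x|.
  have -> : #|S :&: nbhd x| = \sum_(y in S :\ x) (x -- y).
    rewrite card_setI_sum (big_setD1 x) //= in_nbhd sedge_irrefl add0n.
    by apply: eq_bigr => y _; rewrite in_nbhd.
  rewrite -big_split; apply: eq_bigr => y _ /=.
  rewrite (cardsD1 x (S :&: nbhd y)) in_setI xS in_nbhd addnC edgeC; congr (_ + _).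
  by apply: eq_card => z; rewrite !inE andbA.
by have := IH ltac:(lia); move: (\sum_(y in _) _) => X; lia.
Qed.

(** If [C] is smaller than [A], then [X] is smaller than [S]. All but at most one of the at least
    [2 * #|S|] edges at [S] end in [X], so [S] and [X] span at least [#|S| + #|X|] edges, too many
    for a forest. *)
Lemma almost_cover_lower (A B C : {set T}) : bipartition A B ->
  {in A, forall x, 2 <= degree x} ->
  (forall a b a' b', a \notin C -> b \notin C -> a -- b -> a' \notin C -> b' \notin C ->
     a' -- b' -> [set a; b] = [set a'; b']) -> #|A| <= #|C|.
Proof.
move=> hAB degA hC; rewrite leqNgt; apply/negP => ltC.
pose S := A :\: C; pose X := B :&: C.
have AB x : x \in B = (x \notin A) := bipartitionN x hAB.
have ltXS : #|X| < #|S|.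
  have := cardsID C A; have := cardsID A C.
  have -> : C :\: A = X by apply/setP => x; rewrite !inE AB.
  by rewrite setIC -/S; lia.
have unc a y : a \in S -> y \in nbhd a :\: X -> [/\ a \notin C, y \notin C & a -- y].
  move=> /setDP[aA aC] /setDP[]; rewrite in_nbhd => ay; rewrite in_setI negb_and.
  have : y \in B by case/orP: (bipartition_edge hAB ay) => /andP[]; rewrite AB ?aA.
  by move=> -> /= yC; split.
have few : \sum_(a in S) #|nbhd a :\: X| <= 1.
  have [none|] := boolP [forall a in S, nbhd a :\: X == set0].
    rewrite big1 // => a aS; have /forall_inP/(_ a aS)/eqP-> := none; exact: cards0.
  case/forall_inPn => a aS /set0Pn[y yX]; have [aC yC ay] := unc a y aS yX.
  have same a' y' : a' \in S -> y' \in nbhd a' :\: X -> a' = a /\ y' = y.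
    move=> a'S y'X; have [a'C y'C a'y'] := unc a' y' a'S y'X.
    have E := hC _ _ _ _ a'C y'C a'y' aC yC ay.
    have yB : y \in B.
      by case/orP: (bipartition_edge hAB ay) => /andP[]; rewrite AB; case/setDP: aS => ->.
    have a'E : a' = a.
      have : a' \in [set a; y] by rewrite -E set21.
      by case/set2P => // E'; move: yB; rewrite -E' AB; case/setDP: a'S => ->.
    split=> //; have : y' \in [set a; y] by rewrite -E set22.
    by case/set2P => // E'; move: (edge_neq a'y'); rewrite a'E E' eqxx.
  rewrite (big_setD1 a) //= big1 ?addn0.
    rewrite -(cards1 y); apply/subset_leq_card/subsetP => y' y'X.
    by rewrite inE; have [_ ->] := same a y' aS y'X.
  move=> a' /setD1P[na a'S]; apply/eqP; rewrite cards_eq0; apply/eqP/setP => y'.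
  by rewrite in_set0; apply/negP => /(same _ _ a'S)[E _]; rewrite E eqxx in na.
have lower : 2 * #|S| <= \sum_(a in S) #|X :&: nbhd a| + 1.
  apply: leq_trans (leq_add (leqnn _) few); rewrite -big_split /= mulnC -sum_nat_const.
  apply: leq_sum => a /setDP[/degA deg _]; apply: leq_trans deg _.
  by rewrite setIC cardsID.
have nW : S :|: X != set0.
  have /card_gt0P[x xS] : 0 < #|S| by lia.
  by apply/set0Pn; exists x; rewrite inE xS.
have dSX : [disjoint S & X].
  by rewrite -setI_eq0; apply/eqP/setP => x; rewrite !inE AB; case: (x \in A); rewrite ?andbF.
have := forest_degree_sum nW; rewrite cardsU (disjoint_setI0 dSX) cards0 subn0.
have e1 : (S :|: X) :\: S = X.
  by rewrite setDUl setDv set0U; apply/setDidPl; rewrite disjoint_sym.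
rewrite (big_setID S) /= setUK e1.
have le1 : \sum_(a in S) #|X :&: nbhd a| <= \sum_(a in S) #|(S :|: X) :&: nbhd a|.
  by apply: leq_sum => a _; apply/subset_leq_card/setSI/subsetUr.
have le2 : \sum_(a in S) #|X :&: nbhd a| <= \sum_(x in X) #|(S :|: X) :&: nbhd x|.
  by rewrite double_count; apply: leq_sum => a _; apply/subset_leq_card/setSI/subsetUl.
by lia.
Qed.

End Forest.

(** * The extremal graphs *)

(** The last condition admits graphs with degree sum above [M], so it yields both the optimality of
    [Q] and its uniqueness. *)
Lemma extremal_iff (n M : nat) (L : sgraph) (Q : sgraph -> Prop) :
  (exists H, Q H) ->
  (forall G, Q G -> [/\ #|G| = n, ~ contains G L & degree_sum G = M]) ->
  (forall G : sgraph, #|G| = n -> ~ contains G L -> M <= degree_sum G -> Q G) ->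
  forall G, extremal n L G <-> Q G.
Proof.
move=> [H QH] QP upper G; split=> [[cG free max]|QG].
  have [cH freeH dH] := QP H QH; apply: upper => //.
  by rewrite -dH !handshake leq_mul2l max.
have [cG freeG dG] := QP G QG; split=> // G' cG' free'.
rewrite leqNgt; apply/negP => lt.
have le : M < degree_sum G' by rewrite -dG !handshake ltn_mul2l.
by have [_ _ dG'] := QP G' (upper G' cG' free' (ltnW le)); rewrite dG' ltnn in le.
Qed.

Section Free.
Variables (T : sgraph) (A B : {set T}) (n p : nat).
Hypotheses (hAB : bipartition A B) (A_gt0 : 0 < #|A|) (p_gt0 : 0 < p).
Let H := Hgraph n p #|A|.

Let D : {set H} := inl @: [set: 'I_(#|A| - 1)].
Let cl (x : H) : 'I_p := match x : 'I_(#|A| - 1) + 'I_(n - #|A| + 1) with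
  | inl _ => Ordinal p_gt0 | inr i => residue p_gt0 i end.

Let card_D : #|D| = #|A| - 1.
Proof. by rewrite card_imset ?cardsT ?card_ord // => x y []. Qed.

Let adjacent_H (x y : H) : x -- y -> [|| x \in D, y \in D | cl x != cl y].
Proof.
case: x y => [i|i] [j|j] xy; rewrite ?(imset_f _ (in_setT _)) ?orbT //.
have -> : cl (inr i) != cl (inr j) by rewrite /cl residueE; apply: xy.
by rewrite !orbT.
Qed.

(** With [I] empty, [C] is a vertex cover with fewer than [#|A|] vertices, and its complement is
    independent and larger than [B]. *)
Lemma Hgraph_free : independence_number T = #|B| -> ~ contains H (blowup T p.+1).
Proof.
move=> alpha; case/(@blowup_cover T H p D cl (fun _ _ => false) p_gt0) => //.
  by move=> x y /adjacent_H; rewrite orbF.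
move=> C [cC _ cov].
have iC : independent (~: C).
  apply/forall_inP => x; rewrite inE => xC; apply/forall_inP => y; rewrite inE => yC.
  by apply/negP => /(cov x y xC yC)[? []].
have : #|~: C| <= #|B| 
  by rewrite -alpha; exact: (@leq_bigmax_cond _ (@independent T) (fun S : {set T} => #|S|) _ iC).
have BA : B = ~: A by apply/setP => x; rewrite inE (bipartitionN x hAB).
by have := cardsC C; have := cardsC A; rewrite -BA; lia.
Qed.

Lemma Hprime_free (u v : 'I_(n - #|A| + 1)) : acyclic T -> {in A, forall x, 2 <= degree x} ->
  ~ contains (@add_edge H (inr u) (inr v)) (blowup T p.+1).
Proof.
move=> acyc degA.
case/(@blowup_cover T (@add_edge H (inr u) (inr v)) p D cl
  (fun x y => [set x; y] == [set inr u; inr v]) p_gt0).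
- move=> x y; rewrite /sedge /= /add_edge_rel => /orP[/adjacent_H/or3P[]->|/andP[_ ->]];
    by rewrite ?orbT.
- by move=> x y x' y' /eqP-> /eqP->.
move=> C [cC uniq _]; have := almost_cover_lower acyc hAB degA uniq.
by have := leq_trans cC (eq_leq card_D); move: A_gt0; clear; lia.
Qed.

End Free.

Lemma extremal_leaf (T : sgraph) (A B : {set T}) p :
  bipartition A B -> 0 < #|A| -> 3 <= p -> (exists2 a, a \in A & leaf a) ->
  independence_number T = #|B| -> exists n0, forall n, n0 <= n -> forall G : sgraph,
    extremal n (blowup T p.+1) G <-> isomorphic G (Hgraph n p #|A|).
Proof.
move=> hAB A0 p3 hleaf alpha; have p0 : 0 < p by apply: leq_trans p3.
have [m0 [leA core]] := core_leaf hAB A0 p3 hleaf.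
exists (m0 + m0 + turan_missing p (m0 - #|A| + 1)).+1 => n ltn.
have leAn : #|A| <= n by lia.
have dH := degree_sum_Hgraph p0 A0 leAn.
apply: (@extremal_iff n (degree_sum (Hgraph n p #|A|))).
- by exists (Hgraph n p #|A|), id => //; exists id.
- move=> G iso; rewrite (isomorphic_card iso) card_Hgraph // (isomorphic_degree_sum iso).
  split=> // cG; apply: (@Hgraph_free T A B n p hAB A0 p0 alpha).
  by apply: contains_trans cG; case: (isomorphic_contains iso).
move=> G cG free le; subst n.
apply: (@reduction p #|A| 0 m0 (blowup T p.+1) (fun G => isomorphic G (Hgraph #|G| p #|A|))) => //.
- move=> G' leG' free' hdeg' d'; have [D [cl [cD bal adj]]] := core G' leG' free' hdeg' d'.
  by apply: isomorphic_Hgraph bal adj => //; apply: leq_trans leG'.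
- move=> G' leG' iso; rewrite /dense (isomorphic_degree_sum iso).
  by have := degree_sum_Hgraph p0 A0 (leq_trans leA leG'); lia.
- by rewrite /dense; lia.
Qed.

Lemma extremal_degree2 (T : sgraph) (A B : {set T}) p :
  bipartition A B -> acyclic T -> 3 <= p -> is_min_degree_over A 2 ->
  exists n0, forall n, n0 <= n -> forall G : sgraph,
    extremal n (blowup T p.+1) G <-> is_Hprime n p #|A| G.
Proof.
move=> hAB acyc p3 [[a0 a0A d2] degA]; have p0 : 0 < p by apply: leq_trans p3.
have A0 : 0 < #|A| by apply/card_gt0P; exists a0.
have [m0 [leA core]] := core_degree2 hAB A0 p3 a0A d2.
(* The summand [p] ensures that the Turán part contains the vertices [0] and [p], which share a
   class and serve as ends of an extra edge. *)
exists (m0 + m0 + turan_missing p (m0 - #|A| + 1) + p).+1 => n ltn.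
have leAn : #|A| <= n by lia.
have dH n' : #|A| <= n' -> forall u v : 'I_(n' - #|A| + 1), u != v -> u = v %[mod p] ->
    degree_sum (@add_edge (Hgraph n' p #|A|) (inr u) (inr v)) = degree_sum (Hgraph n' p #|A|) + 2.
  move=> le u v nuv Euv; apply: degree_sum_add_edge.
    by apply: contraNneq nuv => -[->].
  by rewrite /sedge /= /turan_rel Euv eqxx.
apply: (@extremal_iff n (degree_sum (Hgraph n p #|A|) + 2)).
- have u0 : 0 < n - #|A| + 1 by lia.
  have v0 : p < n - #|A| + 1 by lia.
  exists (@add_edge (Hgraph n p #|A|) (inr (Ordinal u0)) (inr (Ordinal v0))), (Ordinal u0), (Ordinal v0).
  split; last by exists id => //; exists id.
    by rewrite -val_eqE /= eq_sym -lt0n.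
  by rewrite /= modnn mod0n.
- move=> G [u [v [nuv Euv iso]]].
  rewrite (isomorphic_card iso) (isomorphic_degree_sum iso) dH //.
  split=> //; first exact: card_Hgraph.
  move=> cG; apply: (@Hprime_free T A B n p hAB A0 p0 u v acyc degA).
  by apply: contains_trans cG; case: (isomorphic_contains iso).
move=> G cG free le; subst n.
apply: (@reduction p #|A| 1 m0 (blowup T p.+1) (fun G => is_Hprime #|G| p #|A| G)) => //.
- move=> G' leG' free' hdeg' d'.
  have [D [cl [u [v [cD bal [uD vD nuv cuv] adj]]]]] := core G' leG' free' hdeg' d'.
  by apply: isomorphic_Hprime adj => //; apply: leq_trans leG'.
- move=> G' leG' [u [v [nuv Euv iso]]]; rewrite /dense (isomorphic_degree_sum iso).
  have le' := leq_trans leA leG'; rewrite dH //.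
  by have := degree_sum_Hgraph p0 A0 le'; lia.
- by lia.
- by rewrite /dense; have := degree_sum_Hgraph p0 A0 leAn; lia.
Qed.

Theorem theorem4 (T : sgraph) (A B : {set T}) (p : nat)
    (hT : is_tree T) (hAB : bipartition A B) (hcard : #|A| <= #|B|)
    (hp : 3 <= p) :
  exists n0 : nat, forall n : nat, n0 <= n ->
    ((exists2 a, a \in A & leaf a) -> independence_number T = #|B| ->
       forall G : sgraph,
         extremal n (blowup T p.+1) G <-> isomorphic G (Hgraph n p #|A|))
    /\
    (is_min_degree_over A 2 ->
       forall G : sgraph,
         extremal n (blowup T p.+1) G <-> is_Hprime n p #|A| G).
Proof.
have [_ _ acyc] := hT.
(* The threshold precedes the hypotheses of both cases, so these are decided first; where they fail,
   [0] will do. *)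
have [n1 Hn1] : exists n1, forall n, n1 <= n -> (exists2 a, a \in A & leaf a) ->
    independence_number T = #|B| -> forall G : sgraph,
    extremal n (blowup T p.+1) G <-> isomorphic G (Hgraph n p #|A|).
  have [/exists_inP hleaf|none] := boolP [exists a in A, leaf a]; last first.
    by exists 0 => n _ /exists_inP; rewrite (negPf none).
  have [alpha|/eqP alpha] := eqVneq (independence_number T) #|B|; last by exists 0.
  have A0 : 0 < #|A| by have [a aA _] := hleaf; apply/card_gt0P; exists a.
  by have [n1 Hn1] := extremal_leaf hAB A0 hp hleaf alpha; exists n1 => n le _ _; apply: Hn1.
have [n2 Hn2] : exists n2, forall n, n2 <= n -> is_min_degree_over A 2 -> forall G : sgraph,
    extremal n (blowup T p.+1) G <-> is_Hprime n p #|A| G.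
  have [/andP[/exists_inP[a aA /eqP da] /forall_inP dA]|no] :=
    boolP ([exists a in A, degree a == 2] && [forall a in A, 2 <= degree a]).
    have hmin : is_min_degree_over A 2 by split=> //; exists a.
    by have [n2 Hn2] := extremal_degree2 hAB acyc hp hmin; exists n2 => n le _; apply: Hn2.
  exists 0 => n _ [[a aA da] dA]; case/negP: no; apply/andP; split.
    by apply/exists_inP; exists a => //; apply/eqP.
  exact/forall_inP.
exists (maxn n1 n2) => n; rewrite geq_max => /andP[le1 le2].
by split; [apply: Hn1 | apply: Hn2].
Qed.
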